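(* Let $k\ge 1$ be an integer. The generating function $P_k(z)=\prod_{n=1}^{\infty}\frac{1}{1-z^{n^k}}$, $|z|<1$, of partitions into $k$-th powers belongs to the Hayman class.
   Context: Let $\mathcal{K}$ be the class of nonconstant power series $f(z)=\sum_{n\ge 0}a_nz^n$ with nonnegative coefficients, radius of convergence $R>0$, and $a_0>0$. The Khinchin family of $f\in\mathcal{K}$ is the family $(Z_t)_{t\in[0,R)}$ of random variables with values in $\{0,1,2,\dots\}$ with $\mathbb{P}(Z_t=n)=a_nt^n/f(t)$ for $t\in(0,R)$, $n\ge 0$, and $Z_0\equiv 0$. Its mean and variance are $m_f(t)=\mathbb{E}(Z_t)=tf'(t)/f(t)$ and $\sigma_f^2(t)=\mathbb{V}(Z_t)=t\,m_f'(t)$; one has $\sigma_f(t)>0$ for $t\in(0,R)$, and the normalized variable is $\breve{Z}_t=(Z_t-m_f(t))/\sigma_f(t)$ for $t\in(0,R)$. A power series $f\in\mathcal{K}$ with radius of convergence $R$ is in the Hayman class if $\lim_{t\uparrow R}\sigma_f(t)=+\infty$ and there exists a function $h:[0,R)\to(0,\pi]$ (the cut) such that both $$\lim_{t\uparrow R}\ \sup_{|\theta|\le h(t)\sigma_f(t)}\Big|\mathbb{E}(e^{i\theta\breve{Z}_t})\,e^{\theta^2/2}-1\Big|=0$$ and $$\lim_{t\uparrow R}\ \sigma_f(t)\sup_{h(t)\sigma_f(t)<|\theta|\le\pi\sigma_f(t)}\big|\mathbb{E}(e^{i\theta\breve{Z}_t})\big|=0.$$ The series $P_k$ belongs to $\mathcal{K}$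 and has radius of convergence $R=1$. *)

(* Defs.v *)
(* Stdlib reals with Coquelicot; MathComp is used only for the finite
   combinatorics. *)
From Stdlib Require Import Reals.
From mathcomp Require Import all_boot.
From Coquelicot Require Import Coquelicot.

Set Implicit Arguments.
Unset Strict Implicit.
Unset Printing Implicit Defensive.

Open Scope R_scope.

(* A power series f is represented by its coefficient sequence a, so that
   f t = PSeries a t inside the disk of radius CV_radius a (possibly p_infty). *)
Definition classK (a : nat -> R) : Prop :=
  (forall n, 0 <= a n) /\ 0 < a 0%N /\
  (exists n, (0 < n)%N /\ a n <> 0) /\
  Rbar_lt 0 (CV_radius a).

(* P(Z_t = n).  Since 0 ^ 0 = 1, at t = 0 this is the point mass at 0. *)
Definition khinchin_prob (a : nat -> R) (t : R) (n : nat) : R :=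
  a n * t ^ n / PSeries a t.

(* E(g(Z_t)); for a in classK and 0 <= t < CV_radius a, the series converges
   absolutely whenever g has at most polynomial growth. *)
Definition khinchin_E (a : nat -> R) (t : R) (g : nat -> R) : R :=
  Series (fun n => g n * khinchin_prob a t n).

Definition khinchin_EC (a : nat -> R) (t : R) (g : nat -> C) : C :=
  (khinchin_E a t (fun n => Re (g n)), khinchin_E a t (fun n => Im (g n))).

Definition khinchin_mean (a : nat -> R) (t : R) : R :=
  khinchin_E a t INR.

Definition khinchin_var (a : nat -> R) (t : R) : R :=
  khinchin_E a t (fun n => (INR n - khinchin_mean a t) ^ 2).

Definition khinchin_sigma (a : nat -> R) (t : R) : R :=
  sqrt (khinchin_var a t).

(* The value of the normalized variable on the event Z_t = n. *)
Definition khinchin_normalized (a : nat -> R) (t : R) (n : nat) : R :=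
  (INR n - khinchin_mean a t) / khinchin_sigma a t.

(* exp (i x) *)
Definition expi (x : R) : C := (cos x, sin x).

Definition khinchin_charfun (a : nat -> R) (t theta : R) : C :=
  khinchin_EC a t (fun n => expi (theta * khinchin_normalized a t n)).

(* Supremum of a nonnegative function g over a set A.  The value 0 is adjoined
   so that the supremum over the empty set is 0 rather than m_infty: the second
   range of theta in [hayman] is empty when h t = PI.  Both functions to which
   it is applied there are bounded on A when 0 < t < CV_radius a, so that taking
   [real] of the extended real supremum loses nothing. *)
Definition sup_on (A : R -> Prop) (g : R -> R) : R :=
  real (Lub_Rbar (fun y => y = 0 \/ exists x, A x /\ y = g x)).

(* The filter of t tending to r from below, for r finite or p_infty. *)
Definition left_nbhs (r : Rbar) : (R -> Prop) -> Prop :=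
  within (fun t : R => Rbar_lt t r) (Rbar_locally r).

Definition hayman (a : nat -> R) : Prop :=
  classK a /\
  filterlim (khinchin_sigma a) (left_nbhs (CV_radius a))
    (Rbar_locally p_infty) /\
  exists h : R -> R,
    (forall t : R, 0 <= t -> Rbar_lt t (CV_radius a) -> 0 < h t <= PI) /\
    filterlim
      (fun t => sup_on
         (fun theta => Rabs theta <= h t * khinchin_sigma a t)
         (fun theta => Cmod (khinchin_charfun a t theta
                             * RtoC (exp (theta ^ 2 / 2)) - 1)%C))
      (left_nbhs (CV_radius a)) (locally 0) /\
    filterlim
      (fun t => khinchin_sigma a t * sup_on
         (fun theta => h t * khinchin_sigma a t < Rabs theta
                       <= PI * khinchin_sigma a t)
         (fun theta => Cmod (khinchin_charfun a t theta)))
      (left_nbhs (CV_radius a)) (locally 0).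

(* Number of partitions of n into positive k-th powers, for k >= 1: m i is the
   multiplicity of the part (i+1)^k.  Parts and multiplicities are at most n,
   so that the index ranges lose nothing. *)
Definition num_power_partitions (k n : nat) : nat :=
  #|[set m : {ffun 'I_n -> 'I_n.+1} | (\sum_(i < n) m i * i.+1 ^ k)%N == n]|.

Definition power_partition_series (k : nat) : nat -> R :=
  fun n => INR (num_power_partitions k n).

Definition power_partial_product (k : nat) (z : C) (N : nat) : C :=
  \big[Cmult/RtoC 1]_(1 <= n < N.+1) (1 / (1 - z ^ (n ^ k)%N))%C.

(* Main.v *)
Require Import Defs.
From HB Require Import structures.
From Stdlib Require Import Reals Lra Lia.
From mathcomp Require Import all_boot.
From Coquelicot Require Import Coquelicot.
Set Implicit Arguments.
Unset Strict Implicit.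
Unset Printing Implicit Defensive.
Delimit Scope R_scope with coqR.

(** Write t = exp(-s) and let Z be the Khinchin variable of P_k at t.  The
    product formula says that Z is a sum of independent variables n^k G_n, with
    G_n geometric of ratio q_n = t^(n^k).  So its characteristic function is

      phi |-> prod_n (1 - q_n) / (1 - q_n exp(i n^k phi)),

    and the sums A, B, K of q_n (n^k / (1 - q_n))^j for j = 1, 2, 3 are its mean,
    its variance and the size of its third cumulant.  With u = s^(1/k) the
    relevant n are those of order 1/u, and the three sums are O(s^-j / u).

    Major arc.  For one factor, the inverse of the characteristic function
    times the Gaussian with the same two moments differs from 1 by at most
    6 q (n^k |phi| / (1 - q))^3, for every real phi
    ([geometric_factor_approx]).  Multiplying over n, the characteristic
    function of Z differs from the Gaussian by a relative error
    O(|phi|^3 K) ([major_arc]), which tends to 0 if |phi| <= s w^2 with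
    u = w^5, since then |phi|^3 K = O(w).  That A and B are indeed the mean
    and the variance follows from the same estimate, by comparison with the
    Taylor expansion of E(exp(i phi Z)) at phi = 0 ([raw_moments_eq]); no
    infinite product has to be differentiated.

    Minor arc.  Put y = |phi| / 2.  The squared modulus of the n-th factor is
    1 / (1 + X_n) with X_n = 4 q_n sin^2(n^k y) / (1 - q_n)^2, and for n <= 1/u
    one has X_n >= sin^2(n^k y) and X_n >= (sin(n^k y) / (s n^k))^2.  What is
    needed is therefore that sin(n^k y) is not small for a positive proportion
    of the n <= 1/u.  Exponential sums can be avoided: only a lower bound for a
    sum of squares is wanted, and |sin| is subadditive.  The k-th difference of
    n^k y with step d is k! d^k y, so if |sin(k! d^k y)| is bounded below, each
    window a, a + d, ..., a + k d contains a good n ([windows_sum]).  Writing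
    k! y = p pi + b with |b| <= pi / 2, a suitable d exists unless |b| = O(s).
    In that case, if p > 0, every n = 1 mod k! is good, because n^k y is then
    close to y modulo pi; if p = 0, y itself is O(s), and X_n is at least of
    order (y / s)^2 for all n in question ([sin_power_sum_dichotomy]).  As
    (phi / s)^2 >= w^4 outside the major arc, the characteristic function is
    at most exp(-c w^4 / u) = exp(-c / w) there ([minor_arc]), which beats the
    polynomial growth of the standard deviation. *)

(** * Finite sums and products of real and complex numbers *)

HB.instance Definition _ := Monoid.isComLaw.Build R 0 Rplus
  (fun x y z => esym (Rplus_assoc x y z)) Rplus_comm Rplus_0_l.
HB.instance Definition _ := Monoid.isComLaw.Build R 1 Rmult
  (fun x y z => esym (Rmult_assoc x y z)) Rmult_comm Rmult_1_l.
HB.instance Definition _ := Monoid.isComLaw.Build C (RtoC 0) Cplus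
  Cplus_assoc Cplus_comm Cplus_0_l.
HB.instance Definition _ := Monoid.isComLaw.Build C (RtoC 1) Cmult
  Cmult_assoc Cmult_comm Cmult_1_l.
HB.instance Definition _ := Monoid.isMulLaw.Build C (RtoC 0) Cmult
  Cmult_0_l Cmult_0_r.
HB.instance Definition _ := Monoid.isAddLaw.Build C Cmult Cplus
  Cmult_plus_distr_r Cmult_plus_distr_l.

(** * Partitions with bounded parts and multiplicities *)

Lemma INR_expn n k : INR (n ^ k)%N = INR n ^ k.
Proof. elim: k => [|k IH] //=; by rewrite expnS -multE mult_INR IH. Qed.

(** Bounding both the number of available parts and the multiplicities turns the
    generating function into a finite product of finite sums. *)
Definition num_bounded_partitions (k N B n : nat) : nat :=
  #|[set m : {ffun 'I_N -> 'I_B.+1} | (\sum_(i < N) m i * i.+1 ^ k)%N == n]|.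

(** Vectors of multiplicities with different ranges are compared as functions on
    nat. *)
Definition zero_ext N B (m : {ffun 'I_N -> 'I_B.+1}) (i : nat) : nat :=
  if insub i is Some j then m j else 0.

Lemma zero_extE N B (m : {ffun 'I_N -> 'I_B.+1}) (j : 'I_N) :
  zero_ext m j = m j.
Proof. by rewrite /zero_ext valK. Qed.

Lemma zero_ext_large N B (m : {ffun 'I_N -> 'I_B.+1}) i :
  (N <= i)%N -> zero_ext m i = 0%N.
Proof. by move=> h; rewrite /zero_ext insubF // ltnNge h. Qed.

Lemma sum_zero_ext k N B (m : {ffun 'I_N -> 'I_B.+1}) L :
  (forall i, (L <= i)%N -> zero_ext m i = 0%N) ->
  (\sum_(i < N) m i * i.+1 ^ k = \sum_(i < L) zero_ext m i * i.+1 ^ k)%N.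
Proof.
move=> hL.
transitivity (\sum_(0 <= i < maxn N L) zero_ext m i * i.+1 ^ k)%N.
  rewrite (@big_cat_nat _ _ _ N) ?leq_maxl //= [X in (_ + X)%N]big1_seq ?addn0.
    by rewrite big_mkord; apply: eq_bigr => i _; rewrite zero_extE.
  by move=> i /=; rewrite mem_index_iota => /andP[h _]; rewrite zero_ext_large.
rewrite (@big_cat_nat _ _ _ L) ?leq_maxr //= [X in (_ + X)%N]big1_seq ?addn0.
  by rewrite big_mkord.
by move=> i /=; rewrite mem_index_iota => /andP[h _]; rewrite hL.
Qed.

Lemma solution_bounds k N B n (m : {ffun 'I_N -> 'I_B.+1}) i :
  (0 < k)%N -> (\sum_(i < N) m i * i.+1 ^ k)%N = n ->
  (zero_ext m i <= n)%N /\ ((n <= i)%N -> zero_ext m i = 0%N).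
Proof.
move=> hk hm; case: (ltnP i N) => hi; last by rewrite zero_ext_large.
have h : (zero_ext m i * i.+1 ^ k <= n)%N.
  by rewrite -hm (bigD1 (Ordinal hi)) //= -(zero_extE m (Ordinal hi)) leq_addr.
have h1 : (i.+1 <= i.+1 ^ k)%N by rewrite -{1}(expn1 i.+1) leq_pexp2l.
split.
  by apply: leq_trans h; rewrite leq_pmulr // expn_gt0.
move=> hni; case: (zero_ext m i) h => // z h.
have: (i.+1 <= n)%N.
  by apply: leq_trans h; apply: (leq_trans h1); rewrite leq_pmull.
by rewrite ltnNge hni.
Qed.

(** A solution of total n only uses parts and multiplicities that are at most n.
    So once both bounds of the target reach n, truncation and extension by zero
    turn solutions into solutions, injectively.  Used in both directions, this
    gives the stabilisation of the counts; used in one, their domination by the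
    number of all partitions. *)
Lemma num_bounded_partitions_le k N1 B1 N2 B2 n :
  (0 < k)%N -> (n <= N2)%N -> (n <= B2)%N ->
  (num_bounded_partitions k N1 B1 n <= num_bounded_partitions k N2 B2 n)%N.
Proof.
move=> hk hN hB.
pose T (m : {ffun 'I_N1 -> 'I_B1.+1}) : {ffun 'I_N2 -> 'I_B2.+1} :=
  [ffun i : 'I_N2 => inord (zero_ext m i)].
have TE (m : {ffun 'I_N1 -> 'I_B1.+1}) (i : nat) :
  (\sum_(i < N1) m i * i.+1 ^ k)%N = n -> zero_ext (T m) i = zero_ext m i.
  move=> hm; case: (solution_bounds i hk hm) => h1 h2.
  case: (ltnP i N2) => hi; last first.
    by rewrite zero_ext_large // h2 // (leq_trans hN).
  have -> := zero_extE (T m) (Ordinal hi); rewrite ffunE inordK //.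
  by rewrite ltnS (leq_trans h1).
rewrite /num_bounded_partitions -(@card_in_imset _ _ T); last first.
  move=> m1 m2; rewrite !inE => /eqP h1 /eqP h2 e; apply/ffunP => i; apply: val_inj.
  by rewrite /= -!zero_extE -!TE // e.
apply/subset_leq_card/subsetP => y /imsetP[m].
  rewrite !inE => /eqP hm ->; apply/eqP; rewrite -[RHS]hm.
  rewrite (@sum_zero_ext k N1 B1 m N2); last first.
    move=> i hi; apply: (proj2 (solution_bounds i hk hm)); exact: leq_trans hi.
  by apply: eq_bigr => i _; rewrite -zero_extE TE.
Qed.

Lemma num_power_partitions_gt0 k n : (0 < num_power_partitions k n)%N.
Proof.
rewrite /num_power_partitions; apply/card_gt0P.
case: n => [|n].
  by exists [ffun=> ord0]; rewrite inE big_ord0.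
exists [ffun i : 'I_n.+1 => if i == ord0 then ord_max else ord0].
rewrite inE (bigD1 ord0) //= ffunE eqxx /= exp1n muln1 big1 ?addn0 //.
by move=> i hi; rewrite ffunE (negbTE hi).
Qed.

Lemma Cpow_sum (z : C) (I : Type) (r : seq I) (F : I -> nat) :
  \big[Cmult/RtoC 1]_(i <- r) Cpow z (F i) = Cpow z (\sum_(i <- r) F i).
Proof.
elim: r => [|x r IH]; first by rewrite !big_nil.
by rewrite !big_cons IH -Cpow_add_r.
Qed.

Lemma Csum_const (c : C) (I : finType) (A : {pred I}) :
  \big[Cplus/RtoC 0]_(i in A) c = Cmult (RtoC (INR #|A|)) c.
Proof.
rewrite big_const; elim: #|A| => [|n IH]; first by rewrite /= Cmult_0_l.
by rewrite iterS IH S_INR RtoC_plus Cmult_plus_distr_r Cmult_1_l Cplus_comm.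
Qed.

(** By distributivity a term of the expanded product is a vector of
    multiplicities; the terms are then collected by degree.  The bound L is any
    number exceeding all the degrees. *)
Lemma truncated_product_expansion k N B (z : C) L :
  (N * (B * N ^ k) < L)%N ->
  \big[Cmult/RtoC 1]_(i < N) \big[Cplus/RtoC 0]_(j < B.+1)
     Cpow (Cpow z (i.+1 ^ k)%N) j
  = \big[Cplus/RtoC 0]_(n < L)
      Cmult (RtoC (INR (num_bounded_partitions k N B n))) (Cpow z n).
Proof.
move=> hL; rewrite bigA_distr_bigA.
pose S (m : {ffun 'I_N -> 'I_B.+1}) := (\sum_(i < N) m i * i.+1 ^ k)%N.
have hS m : (S m < L)%N.
  apply: leq_ltn_trans hL; rewrite -[X in (X * _)%N]card_ord -sum_nat_const.
  apply: leq_sum => i _; apply: leq_mul; first by rewrite -ltnS.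
  by case: (k) => [//|k']; rewrite leq_exp2r.
rewrite (eq_bigr (fun m => Cpow z (S m))); last first.
  move=> m _; rewrite /S -Cpow_sum; apply: eq_bigr => i _.
  by rewrite -Cpow_mult_r; congr Cpow; exact: mulnC.
rewrite (partition_big (fun m => Ordinal (hS m)) predT) //=.
apply: eq_bigr => n _; rewrite -Csum_const; apply: eq_big => m /=.
  by rewrite inE -val_eqE.
by move=> /eqP <-.
Qed.

(** * Complex sequences, sums and series *)

(** Convergence in C is phrased through a real sequence, so that squeezing and
    the order on R apply to it directly. *)
Definition is_Clim_seq (u : nat -> C) (l : C) : Prop :=
  is_lim_seq (fun n => Cmod (u n - l)%C) 0.

Lemma is_lim_seq_squeeze0 (u v : nat -> R) :
  (forall n, 0 <= u n <= v n) -> is_lim_seq v 0 -> is_lim_seq u 0.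
Proof.
move=> h hv; apply: (is_lim_seq_le_le (fun=> 0) u v) => //; exact: is_lim_seq_const.
Qed.

Lemma is_Clim_seq_const (c : C) : is_Clim_seq (fun=> c) c.
Proof.
apply: (is_lim_seq_ext (fun=> 0)); last exact: is_lim_seq_const.
by move=> _; rewrite /Cminus Cplus_opp_r Cmod_0.
Qed.

Lemma is_Clim_seq_mult (u v : nat -> C) (a b : C) :
  is_Clim_seq u a -> is_Clim_seq v b -> is_Clim_seq (fun n => (u n * v n)%C) (a * b)%C.
Proof.
move=> hu hv.
apply: (@is_lim_seq_squeeze0 _ (fun n => Cmod (u n - a)%C * Cmod (v n - b)%C +
   (Cmod (u n - a)%C * Cmod b + Cmod a * Cmod (v n - b)%C))).
  move=> n; split; first exact: Cmod_ge_0.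
  rewrite -!Cmod_mult.
  have -> : (u n * v n - a * b = (u n - a) * (v n - b) + ((u n - a) * b + a * (v n - b)))%C by ring.
  apply: Rle_trans (Cmod_triangle _ _) _; apply: Rplus_le_compat_l; exact: Cmod_triangle.
have -> : Finite 0 = Finite (0 * 0 + (0 * Cmod b + Cmod a * 0)) by congr Finite; ring.
apply: is_lim_seq_plus'; first exact: is_lim_seq_mult'.
apply: is_lim_seq_plus'; apply: is_lim_seq_mult' => //; exact: is_lim_seq_const.
Qed.

Lemma is_Clim_seq_prod (I : Type) (r : seq I) (u : nat -> I -> C) (l : I -> C) :
  (forall i, is_Clim_seq (fun n => u n i) (l i)) ->
  is_Clim_seq (fun n => \big[Cmult/RtoC 1]_(i <- r) u n i) (\big[Cmult/RtoC 1]_(i <- r) l i).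
Proof.
move=> h; elim: r => [|i r IH].
  rewrite big_nil; apply: is_lim_seq_ext (is_Clim_seq_const _) => n; by rewrite big_nil.
rewrite big_cons; apply: is_lim_seq_ext (is_Clim_seq_mult (h i) IH) => n.
by rewrite big_cons.
Qed.

Lemma is_Clim_seq_Cmod_le (u : nat -> C) (l c : C) (b : R) :
  is_Clim_seq u l -> eventually (fun n => Cmod (u n - c)%C <= b) -> Cmod (l - c)%C <= b.
Proof.
move=> hu [N hb].
have h : Rbar_le (Cmod (l - c)%C - b) 0.
  apply: (is_lim_seq_le_loc (fun=> Cmod (l - c)%C - b) _ _ _ _ (is_lim_seq_const _) hu).
  exists N => n hn; have := hb n hn => h1.
  have : Cmod (l - c)%C <= Cmod (u n - l)%C + Cmod (u n - c)%C.
    have -> : (l - c = - (u n - l) + (u n - c))%C by ring.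
    by apply: Rle_trans (Cmod_triangle _ _) _; rewrite Cmod_opp; lra.
  lra.
simpl in h; lra.
Qed.

Lemma is_Clim_seq_filterlim (u : nat -> C) (l : C) :
  is_Clim_seq u l -> filterlim u eventually (locally l).
Proof.
move=> hu; apply/filterlim_locally => eps.
move/is_lim_seq_spec: hu => /(_ eps) [N hN].
exists N => n hn; have := hN n hn; rewrite Rminus_0_r Rabs_pos_eq; last exact: Cmod_ge_0.
by move=> h; apply: C_NormedModule_mixin_compat1.
Qed.

Lemma Cmod_sum_le (I : Type) (r : seq I) (P : pred I) (F : I -> C) :
  Cmod (\big[Cplus/RtoC 0]_(i <- r | P i) F i) <= \big[Rplus/0]_(i <- r | P i) Cmod (F i).
Proof.
elim/big_ind2: _ => [|x a y b h1 h2|i _]; last exact: Rle_refl.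
  rewrite Cmod_0; lra.
apply: Rle_trans (Cmod_triangle _ _) _; lra.
Qed.

Lemma Cmod_prod (I : Type) (r : seq I) (P : pred I) (F : I -> C) :
  Cmod (\big[Cmult/RtoC 1]_(i <- r | P i) F i) = \big[Rmult/1]_(i <- r | P i) Cmod (F i).
Proof. by apply: big_morph; [exact: Cmod_mult | exact: Cmod_1]. Qed.

Lemma RtoC_sum (I : Type) (r : seq I) (P : pred I) (F : I -> R) :
  RtoC (\big[Rplus/0]_(i <- r | P i) F i) = \big[Cplus/RtoC 0]_(i <- r | P i) RtoC (F i).
Proof. by apply: big_morph; first exact: RtoC_plus. Qed.

Lemma RtoC_prod (I : Type) (r : seq I) (P : pred I) (F : I -> R) :
  RtoC (\big[Rmult/1]_(i <- r | P i) F i) = \big[Cmult/RtoC 1]_(i <- r | P i) RtoC (F i).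
Proof. by apply: big_morph; first exact: RtoC_mult. Qed.

Lemma Rsum_le (I : Type) (r : seq I) (P : pred I) (F G : I -> R) :
  (forall i, P i -> F i <= G i) ->
  \big[Rplus/0]_(i <- r | P i) F i <= \big[Rplus/0]_(i <- r | P i) G i.
Proof.
move=> h; elim/big_ind2: _ => //; first exact: Rle_refl.
move=> *; exact: Rplus_le_compat.
Qed.

Lemma Rsum_ge0 (I : Type) (r : seq I) (P : pred I) (F : I -> R) :
  (forall i, P i -> 0 <= F i) -> 0 <= \big[Rplus/0]_(i <- r | P i) F i.
Proof. by move=> h; elim/big_ind: _ => // *; lra. Qed.

Lemma Rprod_le (I : Type) (r : seq I) (P : pred I) (F G : I -> R) :
  (forall i, P i -> 0 <= F i <= G i) ->
  \big[Rmult/1]_(i <- r | P i) F i <= \big[Rmult/1]_(i <- r | P i) G i.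
Proof.
move=> h; suff: 0 <= \big[Rmult/1]_(i <- r | P i) F i <= \big[Rmult/1]_(i <- r | P i) G i by case.
elim/big_ind2: _ => //; first lra.
by move=> x a y b [h1 h2] [h3 h4]; split; [apply: Rmult_le_pos | apply: Rmult_le_compat].
Qed.

Lemma exp_sum (I : Type) (r : seq I) (P : pred I) (F : I -> R) :
  exp (\big[Rplus/0]_(i <- r | P i) F i) = \big[Rmult/1]_(i <- r | P i) exp (F i).
Proof. by apply: big_morph; [exact: exp_plus | exact: exp_0]. Qed.

Lemma Rsum_distrr (I : Type) (r : seq I) (P : pred I) (F : I -> R) (c : R) :
  c * \big[Rplus/0]_(i <- r | P i) F i = \big[Rplus/0]_(i <- r | P i) (c * F i).
Proof. by apply: (big_morph (fun x => c * x)); [exact: Rmult_plus_distr_l | exact: Rmult_0_r]. Qed.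

Lemma sum_n_big (a : nat -> R) n : sum_n a n = \big[Rplus/0]_(i < n.+1) a i.
Proof.
elim: n => [|n IH]; first by rewrite sum_O big_ord1.
by rewrite sum_Sn IH [RHS]big_ord_recr.
Qed.

Lemma sum_n_bigC (a : nat -> C) n :
  @sum_n C_AbelianMonoid a n = \big[Cplus/RtoC 0]_(i < n.+1) a i.
Proof.
elim: n => [|n IH]; first by rewrite sum_O big_ord1.
by rewrite sum_Sn IH [RHS]big_ord_recr.
Qed.

Lemma is_series_big (a : nat -> R) (l : R) :
  is_series a l -> is_lim_seq (fun n => \big[Rplus/0]_(i < n) a i) l.
Proof.
move=> h; apply/is_lim_seq_incr_1; apply: (is_lim_seq_ext (sum_n a)) => // n.
by rewrite sum_n_big.
Qed.

Lemma big_le_Series (a : nat -> R) n :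
  (forall i, 0 <= a i) -> ex_series a -> \big[Rplus/0]_(i < n) a i <= Series a.
Proof.
move=> ha /Series_correct h.
apply: (is_lim_seq_incr_compare _ _ (is_series_big h)) => m.
by rewrite big_ord_recr /=; have := ha m; lra.
Qed.

Lemma ex_series_bounded (a : nat -> R) (M : R) :
  (forall i, 0 <= a i) -> (forall n, \big[Rplus/0]_(i < n) a i <= M) -> ex_series a.
Proof.
move=> ha hM.
have [l hl] : ex_finite_lim_seq (sum_n a).
  apply: (ex_finite_lim_seq_incr _ M) => n.
    by rewrite sum_Sn; have := ha n.+1; rewrite /plus /=; lra.
  by rewrite sum_n_big; exact: hM.
by exists l.
Qed.

Lemma Series_bounded (a : nat -> R) (M : R) :
  (forall i, 0 <= a i) -> (forall n, \big[Rplus/0]_(i < n) a i <= M) -> Series a <= M.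
Proof.
move=> ha hM; have /Series_correct /is_series_big h := ex_series_bounded ha hM.
exact: (is_lim_seq_le _ (fun=> M) _ _ hM h (is_lim_seq_const M)).
Qed.

(** * The generating function of partitions into k-th powers *)

Lemma leR_nat m n : (m <= n)%N -> INR m <= INR n.
Proof. by move/leP; exact: le_INR. Qed.

Lemma power_partition_series_pos k n : 0 < power_partition_series k n.
Proof. by apply: lt_0_INR; apply/ltP; exact: num_power_partitions_gt0. Qed.

Lemma geometric_sum_le (x : R) n : 0 <= x < 1 -> \big[Rplus/0]_(j < n) x ^ j <= / (1 - x).
Proof.
move=> hx.
have e : \big[Rplus/0]_(j < n) x ^ j = (1 - x ^ n) * / (1 - x).
  elim: n => [|n IH]; first by rewrite big_ord0 /=; ring.
  by rewrite big_ord_recr IH /=; field; lra.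
rewrite e; have := pow_le x n (proj1 hx); have := Rinv_0_lt_compat (1 - x).
nra.
Qed.

Lemma pow_decr (x : R) m n : 0 <= x <= 1 -> (m <= n)%N -> x ^ n <= x ^ m.
Proof.
move=> hx /subnK <-; elim: (n - m)%N => [|d IH]; first exact: Rle_refl.
rewrite addSn /=; have := pow_le x (d + m)%N (proj1 hx); nra.
Qed.

Lemma leq_self_expn n k : (0 < k)%N -> (n <= n ^ k)%N.
Proof. by case: n => [|n] // hk; rewrite -{1}(expn1 n.+1) leq_pexp2l. Qed.

(** The bound must not depend on N and B: a geometric sum of ratio
    r^((i+1)^k) is at most exp(r^i / (1 - r)), and these exponents are
    summable. *)
Lemma truncated_product_le k N B (r : R) : (0 < k)%N -> 0 <= r < 1 ->
  \big[Rmult/1]_(i < N) \big[Rplus/0]_(j < B.+1) (r ^ (i.+1 ^ k)%N) ^ j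
    <= exp (/ (1 - r) * / (1 - r)).
Proof.
move=> hk hr.
have h1 : 0 < / (1 - r) by apply: Rinv_0_lt_compat; lra.
apply: (Rle_trans _ (\big[Rmult/1]_(i < N) exp (/ (1 - r) * r ^ i))).
  apply: Rprod_le => i _.
  have hp : 0 <= r ^ (i.+1 ^ k)%N by apply: pow_le; lra.
  have hle : r ^ (i.+1 ^ k)%N <= r ^ i.+1.
    by apply: pow_decr; [lra | exact: leq_self_expn].
  have hi : 0 <= r ^ i by apply: pow_le; lra.
  have hle2 : r ^ i.+1 <= r ^ i by rewrite /=; nra.
  have hr1 : r ^ i.+1 <= r.
    rewrite -[X in _ <= X]pow_1; apply: pow_decr => //; lra.
  split; first by apply: Rsum_ge0 => j _; exact: pow_le.
  apply: Rle_trans (geometric_sum_le _ _) _; first lra.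
  apply: Rle_trans (exp_ineq1_le _).
  set x := r ^ _ in hp hle *.
  have h2 : / (1 - x) <= / (1 - r) by apply: Rinv_le_contravar; lra.
  have -> : / (1 - x) = 1 + / (1 - x) * x by field; lra.
  apply: Rplus_le_compat_l; apply: Rmult_le_compat => //; last lra.
  by left; apply: Rinv_0_lt_compat; lra.
rewrite -exp_sum -Rsum_distrr.
case: (Rle_lt_or_eq_dec (\big[Rplus/0]_(i < N) r ^ i) (/ (1 - r))).
- exact: geometric_sum_le.
- by move=> h; left; apply: exp_increasing; exact: Rmult_lt_compat_l.
- by move=> ->; exact: Rle_refl.
Qed.

Lemma truncated_product_expansionR k N B (r : R) L :
  (N * (B * N ^ k) < L)%N ->
  \big[Rmult/1]_(i < N) \big[Rplus/0]_(j < B.+1) (r ^ (i.+1 ^ k)%N) ^ j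
  = \big[Rplus/0]_(n < L) (INR (num_bounded_partitions k N B n) * r ^ n).
Proof.
move=> hL; apply: RtoC_inj.
rewrite RtoC_prod RtoC_sum.
under eq_bigr => i _.
  rewrite RtoC_sum; under eq_bigr => j _ do rewrite !RtoC_pow.
  over.
under [RHS]eq_bigr => i _ do rewrite RtoC_mult RtoC_pow.
exact: truncated_product_expansion.
Qed.

(** Up to degree n the series coincides with a truncated product whose other
    terms are nonnegative; this is what gives convergence in the unit disk. *)
Lemma partition_partial_sum_le k (r : R) n : (0 < k)%N -> 0 <= r < 1 ->
  \big[Rplus/0]_(i < n) (power_partition_series k i * r ^ i)
    <= exp (/ (1 - r) * / (1 - r)).
Proof.
move=> hk hr; apply: Rle_trans (truncated_product_le n n hk hr).
set L := maxn n (n * (n * n ^ k)).+1.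
rewrite (@truncated_product_expansionR k n n r L) ?leq_maxr //.
rewrite -(big_mkord predT (fun i => INR (num_bounded_partitions k n n i) * r ^ i)).
rewrite [X in _ <= X](@big_cat_nat _ _ _ n) ?leq_maxl //=.
rewrite -[X in X <= _]Rplus_0_r; apply: Rplus_le_compat; last first.
  by apply: Rsum_ge0 => i _; apply: Rmult_le_pos; [exact: pos_INR | apply: pow_le; lra].
rewrite big_mkord; apply: Rsum_le => i _.
apply: Rmult_le_compat_r; first by apply: pow_le; lra.
apply: leR_nat.
have hi := ltnW (ltn_ord i).
exact: (@num_bounded_partitions_le k i i n n i hk hi hi).
Qed.

Lemma ex_series_partition k (r : R) : (0 < k)%N -> 0 <= r < 1 ->
  ex_series (fun n => power_partition_series k n * r ^ n).
Proof.
move=> hk hr; apply: ex_series_bounded => n; last exact: partition_partial_sum_le.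
apply: Rmult_le_pos; [left; exact: power_partition_series_pos | apply: pow_le; lra].
Qed.

Definition partition_gf k (z : C) : C :=
  (Series (fun n => power_partition_series k n * Re (z ^ n)%C),
   Series (fun n => power_partition_series k n * Im (z ^ n)%C)).

Lemma Cmod_le_Rabs (z : C) : Cmod z <= Rabs (Re z) + Rabs (Im z).
Proof.
have -> : z = ((RtoC (Re z)) + Ci * (RtoC (Im z)))%C by case: z => x y; rewrite /Ci /RtoC /Cplus /Cmult /=; congr pair; ring.
apply: Rle_trans (Cmod_triangle _ _) _.
rewrite Cmod_mult Cmod_Ci !Cmod_R Rmult_1_l /=.
rewrite !Rmult_0_l !Rmult_0_r !Rmult_1_l !Rminus_0_r !Rplus_0_r !Rplus_0_l; exact: Rle_refl.
Qed.

Lemma im_le_Cmod (z : C) : Rabs (Im z) <= Cmod z.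
Proof. apply: Rle_trans (Rmax_Cmod z); exact: Rmax_r. Qed.

Lemma Re_sum (I : Type) (r : seq I) (F : I -> C) :
  Re (\big[Cplus/RtoC 0]_(i <- r) F i) = \big[Rplus/0]_(i <- r) Re (F i).
Proof. by apply: big_morph. Qed.
Lemma Im_sum (I : Type) (r : seq I) (F : I -> C) :
  Im (\big[Cplus/RtoC 0]_(i <- r) F i) = \big[Rplus/0]_(i <- r) Im (F i).
Proof. by apply: big_morph. Qed.

Lemma ex_series_partition_Re k z : (0 < k)%N -> Cmod z < 1 ->
  ex_series (fun n => power_partition_series k n * Re (z ^ n)%C).
Proof.
move=> hk hz.
apply: (ex_series_le _ (fun n => power_partition_series k n * Cmod z ^ n)); last first.
  by apply: ex_series_partition => //; split => //; exact: Cmod_ge_0.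
move=> n; rewrite /norm /= /abs /= Rabs_mult Rabs_pos_eq; last by left; exact: power_partition_series_pos.
apply: Rmult_le_compat_l; first by left; exact: power_partition_series_pos.
by rewrite -Cmod_pow; exact: re_le_Cmod.
Qed.

Lemma ex_series_partition_Im k z : (0 < k)%N -> Cmod z < 1 ->
  ex_series (fun n => power_partition_series k n * Im (z ^ n)%C).
Proof.
move=> hk hz.
apply: (ex_series_le _ (fun n => power_partition_series k n * Cmod z ^ n)); last first.
  by apply: ex_series_partition => //; split => //; exact: Cmod_ge_0.
move=> n; rewrite /norm /= /abs /= Rabs_mult Rabs_pos_eq; last by left; exact: power_partition_series_pos.
apply: Rmult_le_compat_l; first by left; exact: power_partition_series_pos.
by rewrite -Cmod_pow; exact: im_le_Cmod.
Qed.

Lemma partition_gf_lim k z : (0 < k)%N -> Cmod z < 1 ->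
  is_Clim_seq (fun L => \big[Cplus/RtoC 0]_(n < L) (RtoC (power_partition_series k n) * z ^ n)%C)
    (partition_gf k z).
Proof.
move=> hk hz.
have /Series_correct /is_series_big hRe := ex_series_partition_Re hk hz.
have /Series_correct /is_series_big hIm := ex_series_partition_Im hk hz.
set f := fun L => _.
apply: (@is_lim_seq_squeeze0 _ (fun n => Rabs (Re (f n) - Re (partition_gf k z)) + Rabs (Im (f n) - Im (partition_gf k z)))).
  by move=> n; split; [exact: Cmod_ge_0 | exact: Cmod_le_Rabs].
have -> : Finite 0 = Finite (0 + 0) by congr Finite; ring.
apply: is_lim_seq_plus'.
  rewrite -Rabs_R0; apply: (is_lim_seq_abs _ 0).
  rewrite -(Rminus_diag (Re (partition_gf k z))).
  apply: is_lim_seq_minus'; last exact: is_lim_seq_const.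
  apply: is_lim_seq_ext hRe => n; rewrite /f Re_sum; apply: eq_bigr => i _ /=.
  by rewrite Rmult_0_l Rminus_0_r.
rewrite -Rabs_R0; apply: (is_lim_seq_abs _ 0).
rewrite -(Rminus_diag (Im (partition_gf k z))).
apply: is_lim_seq_minus'; last exact: is_lim_seq_const.
apply: is_lim_seq_ext hIm => n; rewrite /f Im_sum; apply: eq_bigr => i _ /=.
by rewrite Rmult_0_l Rplus_0_r.
Qed.

(** The coefficients of the truncated product agree with those of the series
    below degree N and are dominated by them everywhere, so only the tail of the
    series is lost.  Since the bound is uniform in B, letting B tend to infinity
    compares the series with the product of the first N factors. *)
Lemma truncated_product_dist k N B (z : C) : (0 < k)%N -> (N <= B)%N -> Cmod z < 1 ->
  Cmod (\big[Cmult/RtoC 1]_(i < N) \big[Cplus/RtoC 0]_(j < B.+1) Cpow (Cpow z (i.+1 ^ k)%N) j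
         - partition_gf k z)%C
  <= Series (fun n => power_partition_series k n * Cmod z ^ n)
     - \big[Rplus/0]_(n < N) (power_partition_series k n * Cmod z ^ n).
Proof.
move=> hk hNB hz; set r := Cmod z.
have hr : 0 <= r < 1 by split => //; exact: Cmod_ge_0.
have hpos n : 0 <= power_partition_series k n * r ^ n.
  by apply: Rmult_le_pos; [left; exact: power_partition_series_pos | apply: pow_le; lra].
rewrite -Cmod_opp Copp_minus_distr.
apply: (is_Clim_seq_Cmod_le (partition_gf_lim hk hz)).
exists (maxn N (N * (B * N ^ k)).+1) => L /leP; rewrite geq_max => /andP[hNL hL].
rewrite (@truncated_product_expansion k N B z L) //.
have -> : (\big[Cplus/RtoC 0]_(n < L) (RtoC (power_partition_series k n) * z ^ n)
   - \big[Cplus/RtoC 0]_(n < L) (RtoC (INR (num_bounded_partitions k N B n)) * z ^ n)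
   = \big[Cplus/RtoC 0]_(n < L) (RtoC (power_partition_series k n - INR (num_bounded_partitions k N B n)) * z ^ n))%C.
  have -> : forall x y : C, (x - y = x + (- 1) * y)%C by move=> x y; ring.
  have -> (F : 'I_L -> C) : ((- 1) * \big[Cplus/RtoC 0]_(n < L) F n = \big[Cplus/RtoC 0]_(n < L) ((- 1) * F n))%C.
    by apply: (big_morph (fun x => (- 1) * x)%C); [move=> x y; ring | ring].
  rewrite -big_split; apply: eq_bigr => n _ /=; rewrite RtoC_minus; ring.
apply: Rle_trans (Cmod_sum_le _ _ _) _.
have h : \big[Rplus/0]_(n < L) Cmod (RtoC (power_partition_series k n - INR (num_bounded_partitions k N B n)) * z ^ n)%C
   <= \big[Rplus/0]_(N <= n < L) (power_partition_series k n * r ^ n).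
  rewrite -(big_mkord predT (fun n => Cmod (RtoC (power_partition_series k n - INR (num_bounded_partitions k N B n)) * z ^ n)%C)).
  rewrite (@big_cat_nat _ _ _ N) //= -[X in _ <= X]Rplus_0_l.
  have hle n : INR (num_bounded_partitions k N B n) <= power_partition_series k n.
    by apply: leR_nat; exact: (@num_bounded_partitions_le k N B n n n).
  apply: Rplus_le_compat.
    rewrite big_seq big1; first exact: Rle_refl.
    move=> n; rewrite mem_index_iota => /= hn.
    have e : power_partition_series k n = INR (num_bounded_partitions k N B n).
      apply: Rle_antisym => //; apply: leR_nat.
      by apply: (@num_bounded_partitions_le k n n N B n) => //; [exact: ltnW | apply: leq_trans hNB; exact: ltnW].
    by rewrite e Rminus_diag Cmult_0_l Cmod_0.
  apply: Rsum_le => n _; rewrite Cmod_mult Cmod_pow Cmod_R.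
  apply: Rmult_le_compat_r; first exact: (pow_le r n (proj1 hr)).
  have := hle n; have := pos_INR (num_bounded_partitions k N B n) => h1 h2.
  rewrite Rabs_pos_eq; lra.
apply: Rle_trans h _.
have := big_le_Series L hpos (ex_series_partition hk hr).
rewrite -(big_mkord predT (fun n => power_partition_series k n * r ^ n)) (@big_cat_nat _ _ _ N) //= big_mkord.
have aux (a b s : R) : a + b <= s -> b <= s - a by lra.
exact: aux.
Qed.

Lemma geometric_Clim (x : C) : Cmod x < 1 ->
  is_Clim_seq (fun B => \big[Cplus/RtoC 0]_(j < B.+1) Cpow x j) (1 / (1 - x))%C.
Proof.
move=> hx.
have nz : (1 - x)%C <> 0.
  move=> h; have e : x = 1 by rewrite -[x]Cplus_0_l -h; ring.
  by move: hx; rewrite e Cmod_1; lra.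
have hd : 0 < Cmod (1 - x)%C by apply/Cmod_gt_0.
have e n : (\big[Cplus/RtoC 0]_(j < n) Cpow x j = (1 - x ^ n) / (1 - x))%C.
  elim: n => [|n IH]; first by rewrite big_ord0 /=; field.
  by rewrite big_ord_recr IH /=; field.
apply: (is_lim_seq_ext (fun n => / Cmod (1 - x)%C * Cmod x ^ n.+1)).
  move=> n; rewrite e -Cmod_pow -Cmod_inv // -Cmod_mult -Cmod_opp; congr Cmod; field => //.
rewrite -(Rmult_0_r (/ Cmod (1 - x)%C)).
apply: is_lim_seq_mult'; first exact: is_lim_seq_const.
apply/(is_lim_seq_incr_1 (fun n => Cmod x ^ n)); apply: is_lim_seq_geom.
by rewrite Rabs_pos_eq //; exact: Cmod_ge_0.
Qed.

Lemma pow_lt1 (x : R) n : 0 <= x < 1 -> (0 < n)%N -> x ^ n < 1.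
Proof.
move=> hx hn; apply: (Rle_lt_trans _ (x ^ 1)); last by rewrite pow_1; lra.
by apply: pow_decr => //; lra.
Qed.

Lemma power_partial_productE k z N :
  power_partial_product k z N = \big[Cmult/RtoC 1]_(i < N) (1 / (1 - z ^ (i.+1 ^ k)%N))%C.
Proof. by rewrite /power_partial_product big_add1 /= big_mkord. Qed.

Lemma power_product_lim k z : (0 < k)%N -> Cmod z < 1 ->
  is_Clim_seq (power_partial_product k z) (partition_gf k z).
Proof.
move=> hk hz; have hr : 0 <= Cmod z < 1 by split => //; exact: Cmod_ge_0.
apply: (@is_lim_seq_squeeze0 _ (fun N => Series (fun n => power_partition_series k n * Cmod z ^ n)
     - \big[Rplus/0]_(n < N) (power_partition_series k n * Cmod z ^ n))).
  move=> N; split; first exact: Cmod_ge_0.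
  have h : is_Clim_seq (fun B => \big[Cmult/RtoC 1]_(i < N) \big[Cplus/RtoC 0]_(j < B.+1) Cpow (Cpow z (i.+1 ^ k)%N) j)
    (power_partial_product k z N).
    rewrite power_partial_productE; apply: is_Clim_seq_prod => i; apply: geometric_Clim.
    by rewrite Cmod_pow; apply: pow_lt1 => //; rewrite expn_gt0.
  apply: (is_Clim_seq_Cmod_le h); exists N => B /leP hB.
  exact: truncated_product_dist.
set S := Series _; have -> : Finite 0 = Finite (S - S) by rewrite Rminus_diag.
apply: is_lim_seq_minus'; first exact: is_lim_seq_const.
exact: (is_series_big (Series_correct _ (ex_series_partition hk hr))).
Qed.

Lemma is_pseries_partition k z : (0 < k)%N -> Cmod z < 1 ->
  is_pseries (fun n => RtoC (power_partition_series k n)) z (partition_gf k z).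
Proof.
move=> hk hz; rewrite /is_pseries /is_series.
have /is_Clim_seq_filterlim h : is_Clim_seq (fun L => \big[Cplus/RtoC 0]_(n < L.+1) (RtoC (power_partition_series k n) * z ^ n)%C)
    (partition_gf k z).
  exact: ((proj1 (is_lim_seq_incr_1 _ _)) (partition_gf_lim hk hz)).
apply: filterlim_ext h => n.
rewrite [RHS](sum_n_bigC (fun i => scal (pow_n (K := C_AbsRing) z i) (RtoC (power_partition_series k i)))); apply: eq_bigr => i _.
by rewrite /scal /= /mult /= Cmult_comm.
Qed.

Lemma CV_radius_partition k : (0 < k)%N -> CV_radius (power_partition_series k) = 1.
Proof.
move=> hk; apply: Rbar_le_antisym; apply: Rbar_not_lt_le => h.
  have /ex_series_lim_0 : ex_series (fun n => power_partition_series k n * 1 ^ n).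
    by apply/ex_pseries_R; apply: CV_radius_inside; rewrite Rabs_R1.
  move/is_lim_seq_spec; case/(_ (mkposreal 1 Rlt_0_1)) => n /(_ n (le_n _)) /=.
  rewrite pow1 Rminus_0_r Rmult_1_r Rabs_pos_eq; last by left; exact: power_partition_series_pos.
  by have := leR_nat (num_power_partitions_gt0 k n); rewrite /power_partition_series /=; lra.
have [r [h1 h2]] : exists r : R, Rbar_lt (CV_radius (power_partition_series k)) r /\ r < 1.
  move: h; have := CV_radius_ge_0 (power_partition_series k); case: CV_radius => [x| |] //= h1 h2.
  exists ((x + 1) / 2); lra.
have h3 : 0 < r.
  move: h1; have := CV_radius_ge_0 (power_partition_series k); case: CV_radius => [x| |] //=; lra.
apply: (CV_disk_outside (power_partition_series k) r); first by rewrite Rabs_pos_eq //; lra.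
apply: ex_series_lim_0; apply: ex_series_partition => //; lra.
Qed.

Lemma classK_partition k : (0 < k)%N -> classK (power_partition_series k).
Proof.
move=> hk; split; first by move=> n; left; exact: power_partition_series_pos.
split; first exact: power_partition_series_pos.
split; first by exists 1%N; split => //; apply: Rgt_not_eq; exact: power_partition_series_pos.
by rewrite CV_radius_partition //=; lra.
Qed.

(** * Gaussian approximation of a geometric variable *)

(** The Taylor bounds for sine and cosine below are obtained by integrating
    1 - cos >= 0 and 1 - sin >= 0 repeatedly with this lemma. *)
Lemma nonneg_of_derive (f f' : R -> R) :
  (forall x, is_derive f x (f' x)) -> f 0 = 0 ->
  (forall x, 0 <= x -> 0 <= f' x) -> forall x, 0 <= x -> 0 <= f x.
Proof.
move=> hd h0 hp x hx.
have [c [[hc _] e]] : exists c, (Rmin 0 x <= c <= Rmax 0 x) /\ f x - f 0 = f' c * (x - 0).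
  apply: MVT_gen => [y _|y _]; first exact: hd.
  apply/continuity_pt_filterlim; apply: ex_derive_continuous; by exists (f' y).
rewrite Rmin_left // in hc; have := hp c hc; nra.
Qed.

Lemma sin_le_self x : 0 <= x -> sin x <= x.
Proof.
move=> hx; have : 0 <= x - sin x; last lra.
apply: (@nonneg_of_derive (fun x => x - sin x) (fun x => 1 - cos x)) => // [y||y _].
- by auto_derive => //; ring.
- by rewrite sin_0; ring.
- have := COS_bound y; lra.
Qed.

Lemma cos_taylor_nonneg x : 0 <= x -> 0 <= cos x - 1 + x ^ 2 / 2 <= x ^ 3 / 6.
Proof.
have h1 : forall x, 0 <= x -> 0 <= cos x - 1 + x.
  apply: (@nonneg_of_derive _ (fun x => 1 - sin x)) => [y||y _].
  - by auto_derive => //; ring.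
  - by rewrite cos_0; ring.
  - have := SIN_bound y; lra.
have h2 : forall x, 0 <= x -> 0 <= sin x - x + x ^ 2 / 2.
  apply: (@nonneg_of_derive _ (fun x => cos x - 1 + x)) => // [y|].
  - by auto_derive => //; field.
  - by rewrite sin_0; field.
move=> hx; split.
  move: x hx; apply: (@nonneg_of_derive _ (fun x => x - sin x)) => // [y||y hy].
  - by auto_derive => //; field.
  - by rewrite cos_0; field.
  - have := sin_le_self hy; lra.
suff : 0 <= x ^ 3 / 6 - (cos x - 1 + x ^ 2 / 2) by lra.
move: x hx; apply: (@nonneg_of_derive _ (fun x => sin x - x + x ^ 2 / 2)) => // [y|].
- by auto_derive => //; field.
- by rewrite cos_0; field.
Qed.

Lemma sin_taylor_nonneg x : 0 <= x -> 0 <= sin x - x + x ^ 3 / 6.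
Proof.
move: x; apply: (@nonneg_of_derive _ (fun x => cos x - 1 + x ^ 2 / 2)) => // [y||y hy].
- by auto_derive => //; field.
- by rewrite sin_0; field.
- by case: (cos_taylor_nonneg hy).
Qed.

Lemma cos_taylor2 x : Rabs (cos x - (1 - x ^ 2 / 2)) <= Rabs x ^ 3 / 6.
Proof.
wlog hx : x / 0 <= x => [h|].
  case: (Rle_lt_dec 0 x) => hx; first exact: h.
  by have := h (- x); rewrite cos_neg Rabs_Ropp -!Rsqr_pow2 -Rsqr_neg; apply; lra.
have := cos_taylor_nonneg hx; rewrite (Rabs_pos_eq x) // => h.
rewrite Rabs_pos_eq; lra.
Qed.

Lemma sin_taylor1 x : Rabs (sin x - x) <= Rabs x ^ 3 / 6.
Proof.
wlog hx : x / 0 <= x => [h|].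
  case: (Rle_lt_dec 0 x) => hx; first exact: h.
  have := h (- x); rewrite sin_neg Rabs_Ropp.
  have -> : - sin x - - x = - (sin x - x) by ring.
  by rewrite Rabs_Ropp; apply; lra.
have := sin_taylor_nonneg hx; have := sin_le_self hx; rewrite (Rabs_pos_eq x) // => h1 h2.
rewrite Rabs_left1; lra.
Qed.

Lemma expi_plus x y : expi (x + y) = (expi x * expi y)%C.
Proof. by rewrite /expi cos_plus sin_plus /Cmult /=; congr pair; ring. Qed.

Lemma Cmod_expi x : Cmod (expi x) = 1.
Proof.
rewrite /Cmod /expi /= !Rmult_1_r -sqrt_1; congr sqrt.
by have := sin2_cos2 x; rewrite /Rsqr => <-; ring.
Qed.

Lemma expi_0 : expi 0 = RtoC 1.
Proof. by rewrite /expi cos_0 sin_0. Qed.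

Lemma Cmod_expi_sub1 x : Cmod (expi x - 1)%C <= Rabs x.
Proof.
rewrite -(Rabs_pos_eq (Cmod _)); last exact: Cmod_ge_0.
apply: Rsqr_le_abs_0; rewrite !Rsqr_pow2 Cmod2_alt /=.
have [h _] := cos_taylor_nonneg (Rabs_pos x).
have := sin2_cos2 x; rewrite /Rsqr => h2.
have e : cos (Rabs x) = cos x.
  by rewrite /Rabs; case: Rcase_abs => // _; rewrite cos_neg.
rewrite e in h.
have h3 : Rabs x ^ 2 = x ^ 2 by rewrite -!Rsqr_pow2 -Rsqr_abs.
nra.
Qed.

Lemma Cmod_expi_taylor2 x :
  Cmod (expi x - ((1 - x ^ 2 / 2)%coqR, x))%C <= Rabs x ^ 3.
Proof.
apply: Rle_trans (Cmod_le_Rabs _) _ => /=.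
have := cos_taylor2 x; have := sin_taylor1 x => /=; rewrite /Rminus.
have := pow_le (Rabs x) 3 (Rabs_pos x) => /=; lra.
Qed.

(** The third-order comparison of a geometric variable with a Gaussian, written
    for the inverse of its characteristic function so that no logarithm occurs.
    With a = q / (1 - q) the inverse is 1 - a (exp(i psi) - 1), the mean is a and
    the variance a + a^2.  If D = |psi| / (1 - q) <= 1, expand to second order:
    the terms of order at most 2 cancel.  If D > 1, each of the three factors is
    within q D^2 of 1 and the two exponentials have modulus at most 1; so the
    estimate holds for all psi, with the factor q that summability needs. *)
Lemma geometric_factor_approx (q psi : R) : 0 < q < 1 ->
  Cmod ((1 - q * expi psi) / (1 - q) * (expi (q / (1 - q) * psi)%coqR
          * exp (- (q / (1 - q) ^ 2 * psi ^ 2 / 2))) - 1)%C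
  <= 6 * (q * (Rabs psi / (1 - q)) ^ 3).
Proof.
move=> hq.
set a := q / (1 - q); set D := Rabs psi / (1 - q).
have ha : 0 < a by apply: Rdiv_lt_0_compat; lra.
have hD : 0 <= D by apply: Rdiv_le_0_compat; [exact: Rabs_pos | lra].
have -> : q / (1 - q) ^ 2 = a + a ^ 2 by rewrite /a; field; lra.
have hnz : (1 - q)%C <> 0 by rewrite -RtoC_minus => /RtoC_inj; lra.
have -> : ((1 - q * expi psi) / (1 - q) = 1 - a * (expi psi - 1))%C.
  rewrite /a RtoC_div; last lra.
  by rewrite RtoC_minus; field.
set beta := (a + a ^ 2) * psi ^ 2 / 2.
have hbeta : beta = q * D ^ 2 / 2.
  rewrite /beta /D /a -(Rsqr_pow2 psi) Rsqr_abs Rsqr_pow2; field; lra.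
have hal : Rabs (a * psi) = q * D.
  rewrite Rabs_mult (Rabs_pos_eq a); last lra.
  by rewrite /a /D; field; lra.
have hb0 : 0 <= beta by rewrite hbeta; nra.
have hexp : 0 < exp (- beta) <= 1.
  split; first exact: exp_pos.
  rewrite -exp_0; case: (Req_dec beta 0) => [->|h]; first by rewrite Ropp_0; lra.
  by left; apply: exp_increasing; lra.
have hexp1 : 1 - beta <= exp (- beta) by have := exp_ineq1_le (- beta); lra.
case: (Rle_lt_dec D 1) => hD1; last first.
  (* For D > 1 the three factors are compared with 1 one after the other. *)
  have -> : ((1 - a * (expi psi - 1)) * (expi (a * psi)%coqR * exp (- beta)) - 1
    = - (a * (expi psi - 1)) * (expi (a * psi)%coqR * exp (- beta))
      + ((expi (a * psi)%coqR - 1) * exp (- beta) + RtoC (exp (- beta) - 1)))%C.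
    by rewrite RtoC_minus; ring.
  apply: Rle_trans (Cmod_triangle _ _) _.
  apply: Rle_trans (Rplus_le_compat_l _ _ _ (Cmod_triangle _ _)) _.
  rewrite !Cmod_mult Cmod_opp !Cmod_mult !Cmod_R Cmod_expi Rmult_1_l.
  rewrite (Rabs_pos_eq a); last lra.
  rewrite (Rabs_pos_eq (exp _)); last lra.
  rewrite (Rabs_left1 (exp _ - 1)); last lra.
  have h1 := Cmod_expi_sub1 psi.
  have h2 := Cmod_expi_sub1 (a * psi); rewrite hal in h2.
  have h3 : a * Cmod (expi psi - 1)%C <= q * D.
    rewrite -hal Rabs_mult (Rabs_pos_eq a); last lra.
    by apply: Rmult_le_compat_l => //; lra.
  have h4 : a * Cmod (expi psi - 1)%C * exp (- beta) <= q * D.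
    have : 0 <= a * Cmod (expi psi - 1)%C by apply: Rmult_le_pos; [lra | exact: Cmod_ge_0].
    nra.
  have h5 : Cmod (expi (a * psi)%coqR - 1)%C * exp (- beta) <= q * D.
    have := Cmod_ge_0 (expi (a * psi)%coqR - 1)%C; nra.
  have h6 : D <= D ^ 3 by nra.
  have h7 : D ^ 2 <= D ^ 3 by nra.
  nra.
(* For D <= 1 the remainders r3 and s3 are cubic, and the product of the second
   order polynomials is 1 + beta up to the explicit last pair of terms. *)
set r3 := (expi psi - ((1 - psi ^ 2 / 2)%coqR, psi))%C.
set s3 := (expi (a * psi)%coqR - ((1 - (a * psi) ^ 2 / 2)%coqR, (a * psi)%coqR))%C.
have hr3 : Cmod r3 <= Rabs psi ^ 3 := Cmod_expi_taylor2 psi.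
have hs3 : Cmod s3 <= (q * D) ^ 3 by rewrite -hal; exact: Cmod_expi_taylor2.
have -> : ((1 - a * (expi psi - 1)) * (expi (a * psi)%coqR * exp (- beta)) - 1
  = (- (a * r3) * expi (a * psi)%coqR + s3 * ((1 + a * psi ^ 2 / 2)%coqR, (- (a * psi))%coqR)
     + ((- ((a * psi) ^ 2 * (a * psi ^ 2) / 4))%coqR, ((a * psi) * (a * psi ^ 2) / 2 + (a * psi) ^ 3 / 2)%coqR))
    * exp (- beta) + RtoC ((1 + beta) * exp (- beta) - 1))%C.
  rewrite /r3 /s3 /beta /expi /RtoC /Cplus /Cminus /Copp /Cmult /Cplus /=.
  congr pair; field.
have hpsi : Rabs psi = (1 - q) * D by rewrite /D; field; lra.
have hpsi2 : a * psi ^ 2 = q * (1 - q) * D ^ 2.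
  by rewrite -(Rsqr_pow2 psi) Rsqr_abs Rsqr_pow2 hpsi /a; field; lra.
have har3 : a * Cmod r3 <= q * D ^ 3.
  apply: (Rle_trans _ (a * Rabs psi ^ 3)); first by apply: Rmult_le_compat_l; lra.
  have -> : a * Rabs psi ^ 3 = q * (1 - q) ^ 2 * D ^ 3.
    by rewrite hpsi /a; field; lra.
  apply: Rmult_le_compat_r; first exact: pow_le.
  nra.
apply: Rle_trans (Cmod_triangle _ _) _.
rewrite Cmod_mult !Cmod_R (Rabs_pos_eq (exp _)); last lra.
have hD3 : 0 <= D ^ 3 by apply: pow_le.
have hqD : 0 <= q * D <= 1 by nra.
have hqDD : 0 <= q * (1 - q) * D ^ 2 <= 1.
  have : D ^ 2 <= 1 by nra.
  have : 0 <= q * (1 - q) <= 1 by nra.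
  have : 0 <= D ^ 2 by nra.
  nra.
have hq3 : (q * D) ^ 3 <= q * D ^ 3.
  have -> : (q * D) ^ 3 = q * D ^ 3 * q ^ 2 by ring.
  have : 0 <= q * D ^ 3 by nra.
  have : q ^ 2 <= 1 by nra.
  nra.
have hA : Rabs ((1 + beta) * exp (- beta) - 1) <= q * D ^ 3.
  have h1 : exp (- beta) * (1 + beta) <= 1.
    rewrite exp_Ropp; have h := exp_ineq1_le beta; have h0 := exp_pos beta.
    apply: (Rmult_le_reg_l (exp beta)) => //.
    rewrite -Rmult_assoc Rinv_r; lra.
  rewrite Rabs_left1; last lra.
  have : beta ^ 2 <= q * D ^ 3.
    rewrite hbeta.
    have -> : (q * D ^ 2 / 2) ^ 2 = (q * D ^ 3) * (q * D) / 4 by field.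
    have : 0 <= q * D ^ 3 by nra.
    nra.
  nra.
have hB : Cmod (- (a * r3) * expi (a * psi)%coqR)%C <= q * D ^ 3.
  by rewrite Cmod_mult Cmod_opp Cmod_mult Cmod_expi Cmod_R Rabs_pos_eq; lra.
have hC : Cmod (s3 * ((1 + a * psi ^ 2 / 2)%coqR, (- (a * psi))%coqR))%C <= q * D ^ 3 * (5 / 2).
  rewrite Cmod_mult; apply: Rmult_le_compat; try exact: Cmod_ge_0.
    exact: Rle_trans hs3 hq3.
  apply: Rle_trans (Cmod_le_Rabs _) _ => /=.
  rewrite Rabs_Ropp hal -[psi * (psi * 1)]/(psi ^ 2) hpsi2 Rabs_pos_eq; lra.
have hE : Cmod (- ((a * psi) ^ 2 * (a * psi ^ 2) / 4), (a * psi) * (a * psi ^ 2) / 2 + (a * psi) ^ 3 / 2)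
   <= q * D ^ 3 * (5 / 4).
  apply: Rle_trans (Cmod_le_Rabs _) _.
  rewrite /Re /Im /fst /snd Rabs_Ropp.
  have -> : (a * psi) ^ 2 = (q * D) ^ 2 by rewrite -(Rsqr_pow2 (a * psi)) Rsqr_abs Rsqr_pow2 hal.
  have -> : a * psi * (a * psi ^ 2) / 2 + (a * psi) ^ 3 / 2 = (a * psi) * ((a * psi ^ 2) / 2 + (a * psi) ^ 2 / 2) by field.
  have -> : (a * psi) ^ 2 = (q * D) ^ 2 by rewrite -(Rsqr_pow2 (a * psi)) Rsqr_abs Rsqr_pow2 hal.
  rewrite Rabs_mult hal hpsi2.
  have h1 : 0 <= (q * D) ^ 2 * (q * (1 - q) * D ^ 2) / 4 by have := pow2_ge_0 (q * D); nra.
  rewrite Rabs_pos_eq // Rabs_pos_eq; last by have := pow2_ge_0 (q * D); nra.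
  have e1 : q * D * (q * (1 - q) * D ^ 2 / 2 + (q * D) ^ 2 / 2) = q * D ^ 3 * (q / 2) by field.
  have e2 : (q * D) ^ 2 * (q * (1 - q) * D ^ 2) / 4 = (q * D ^ 3) * ((q * D) * (q * (1 - q))) / 4 by field.
  rewrite e1 e2.
  have : 0 <= q * D ^ 3 by nra.
  have : (q * D) * (q * (1 - q)) <= 1 by have : 0 <= q * (1 - q) <= 1 by [nra]; nra.
  nra.
set X := (_ + _ + _)%C.
have hX : Cmod X <= q * D ^ 3 * (19 / 4).
  apply: Rle_trans (Cmod_triangle _ _) _.
  apply: Rle_trans (Rplus_le_compat_r _ _ _ (Cmod_triangle _ _)) _.
  lra.
have := Cmod_ge_0 X; have : 0 <= q * D ^ 3 by nra.
nra.
Qed.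

(** * The characteristic function as a product over the parts *)

(** Expanded in the F i - 1, the left-hand side is dominated term by term by the
    product of the 1 + |F i - 1|, minus 1. *)
Lemma prod_near_one (I : Type) (r : seq I) (F : I -> C) (eps : I -> R) :
  (forall i, Cmod (F i - 1)%C <= eps i) ->
  Cmod (\big[Cmult/RtoC 1]_(i <- r) F i - 1)%C <= exp (\big[Rplus/0]_(i <- r) eps i) - 1.
Proof.
move=> h; elim: r => [|i r IH].
  by rewrite !big_nil exp_0 /Cminus Cplus_opp_r Cmod_0; lra.
rewrite !big_cons; set P := \big[Cmult/RtoC 1]_(j <- r) F j in IH *.
set S := \big[Rplus/0]_(j <- r) eps j in IH *.
have -> : (F i * P - 1 = (F i - 1) * (P - 1) + ((F i - 1) + (P - 1)))%C by ring.
apply: Rle_trans (Cmod_triangle _ _) _.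
apply: Rle_trans (Rplus_le_compat_l _ _ _ (Cmod_triangle _ _)) _.
rewrite Cmod_mult exp_plus.
have h1 := h i; have h2 := exp_ineq1_le (eps i).
have := Cmod_ge_0 (F i - 1)%C; have := Cmod_ge_0 (P - 1)%C; have := exp_pos S.
nra.
Qed.

Lemma Cmod_inv_sub1 (g : C) (e : R) : e < 1 -> Cmod (g - 1)%C <= e ->
  Cmod (/ g - 1)%C <= e / (1 - e).
Proof.
move=> he h.
have h1 : 1 - e <= Cmod g.
  have : Cmod 1 <= Cmod g + Cmod (g - 1)%C.
    have {1}-> : (RtoC 1 = g + - (g - 1))%C by ring.
    by apply: Rle_trans (Cmod_triangle _ _) _; rewrite Cmod_opp; lra.
  rewrite Cmod_1; lra.
have nz : g <> 0 by apply/Cmod_gt_0; lra.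
have -> : (/ g - 1 = - (g - 1) * / g)%C by field.
rewrite Cmod_mult Cmod_opp Cmod_inv //.
apply: Rmult_le_compat => //; first exact: Cmod_ge_0.
  by left; apply: Rinv_0_lt_compat; lra.
by apply: Rinv_le_contravar; lra.
Qed.

(** With t = exp(-u^k), the part of index i is n^k for n = i + 1, the ratio
    t^(n^k) of its geometric multiplicity is exp(-(u n)^k), and its contribution
    to the Khinchin variable has mean [part_moment k u 1 i] and variance
    [part_moment k u 2 i].  The case j = 3 bounds the error of the Gaussian
    approximation. *)
Definition part_weight (k i : nat) : R := INR i.+1 ^ k.
Definition part_prob (k : nat) (u : R) (i : nat) : R := exp (- (u * INR i.+1) ^ k).
Definition part_moment (k : nat) (u : R) (j i : nat) : R :=
  part_prob k u i * (part_weight k i / (1 - part_prob k u i)) ^ j.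

Lemma part_weight_ge1 k i : 1 <= part_weight k i.
Proof.
rewrite -(pow1 k); apply: pow_incr; split; first lra.
by have := leR_nat (ltn0Sn i); rewrite /=.
Qed.

Lemma exp_lt1 x : 0 < x -> 0 < exp (- x) < 1.
Proof.
move=> hx; split; first exact: exp_pos.
rewrite -exp_0; apply: exp_increasing; lra.
Qed.

Lemma part_prob_lt1 k u i : 0 < u -> 0 < part_prob k u i < 1.
Proof.
move=> hu; apply: exp_lt1; apply: pow_lt; apply: Rmult_lt_0_compat => //.
by apply: lt_0_INR; lia.
Qed.

Lemma part_moment_ge0 k u j i : 0 < u -> 0 <= part_moment k u j i.
Proof.
move=> hu; have h := part_prob_lt1 k i hu; apply: Rmult_le_pos; first lra.
apply: pow_le; apply: Rdiv_le_0_compat; last lra.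
by have := part_weight_ge1 k i; lra.
Qed.

Lemma exp_half_le2 : exp (1 / 2) <= 2.
Proof.
have h := exp_le_3; have e : exp 1 = exp (1 / 2) * exp (1 / 2) by rewrite -exp_plus; congr exp; field.
have := exp_pos (1 / 2); nra.
Qed.

(** Since v / (1 - exp(-v)) <= 1 + v <= 6 exp(v / 6), half of the exponential
    decay pays for three such factors. *)
Lemma bose_factor_le (v : R) j : 0 < v -> (j <= 3)%N ->
  exp (- v) * (v / (1 - exp (- v))) ^ j <= 216 * exp (- (v / 2)).
Proof.
move=> hv hj.
have hq := exp_lt1 hv.
have h1 : v / (1 - exp (- v)) <= 1 + v.
  apply: (Rmult_le_reg_r (1 - exp (- v))); first lra.
  have -> : v / (1 - exp (- v)) * (1 - exp (- v)) = v by field; lra.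
  have h : exp (- v) * (1 + v) <= 1.
    rewrite exp_Ropp; have h := exp_ineq1_le v; have h0 := exp_pos v.
    apply: (Rmult_le_reg_l (exp v)) => //.
    rewrite -Rmult_assoc Rinv_r; lra.
  lra.
have h0 : 0 <= v / (1 - exp (- v)) by apply: Rdiv_le_0_compat; lra.
have h2 : 1 + v <= 6 * exp (v / 6) by have := exp_ineq1_le (v / 6); lra.
have h3 : (v / (1 - exp (- v))) ^ j <= (6 * exp (v / 6)) ^ 3.
  apply: (Rle_trans _ ((6 * exp (v / 6)) ^ j)); first by apply: pow_incr; lra.
  by apply: Rle_pow; [lra | apply/leP].
have e : exp (- v) * (6 * exp (v / 6)) ^ 3 = 216 * exp (- (v / 2)).
  have -> : - (v / 2) = - v + (v / 6 + (v / 6 + v / 6)) by field.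
  by rewrite !exp_plus; ring.
rewrite -e; apply: Rmult_le_compat_l => //; lra.
Qed.

Lemma pow_ge_sub1 x k : (0 < k)%N -> 0 <= x -> x - 1 <= x ^ k.
Proof.
move=> hk hx; case: (Rle_lt_dec x 1) => h.
  by have := pow_le x k hx; lra.
have : x ^ 1 <= x ^ k by apply: Rle_pow; [lra | apply/leP].
rewrite pow_1; lra.
Qed.

(** In terms of v = (u n)^k the summand is s^-j times a function of v with
    exponential decay.  As v >= u n - 1, that function is dominated by a geometric
    sequence in n of ratio exp(-u / 2), whose sum is O(1 / u). *)
Lemma part_moment_partial_le k u j N : (0 < k)%N -> 0 < u -> (j <= 3)%N ->
  \big[Rplus/0]_(i < N) part_moment k u j i <= 864 / ((u ^ k) ^ j * u).
Proof.
move=> hk hu hj.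
have hs : 0 < u ^ k by exact: pow_lt.
have hsj : 0 < (u ^ k) ^ j by exact: pow_lt.
set x := exp (- (u / 2)).
have hx : 0 < x < 1 by apply: exp_lt1; lra.
have h1 i : part_moment k u j i <= 432 / (u ^ k) ^ j * x * x ^ i.
  have hi : 0 < INR i.+1 by apply: lt_0_INR; lia.
  set v := (u * INR i.+1) ^ k.
  have hv : 0 < v by apply: pow_lt; exact: Rmult_lt_0_compat.
  have -> : part_moment k u j i = / (u ^ k) ^ j * (exp (- v) * (v / (1 - exp (- v))) ^ j).
    rewrite /part_moment /part_prob -/v /part_weight.
    have -> : INR i.+1 ^ k = v / u ^ k by rewrite /v Rpow_mult_distr; field; lra.
    have hq := exp_lt1 hv.
    rewrite /Rdiv !Rpow_mult_distr !pow_inv; field; split; last lra.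
    by apply: pow_nonzero; lra.
  have -> : 432 / (u ^ k) ^ j * x * x ^ i = / (u ^ k) ^ j * (432 * x ^ i.+1) by rewrite /=; field; lra.
  apply: Rmult_le_compat_l; first by left; exact: Rinv_0_lt_compat.
  apply: Rle_trans (bose_factor_le hv hj) _.
  have hle : u * INR i.+1 - 1 <= v by apply: pow_ge_sub1 => //; nra.
  have : exp (- (v / 2)) <= exp (1 / 2) * x ^ i.+1.
    have -> : x ^ i.+1 = exp (- (u * INR i.+1 / 2)).
      rewrite /x; elim: (i.+1) => [|m IH]; first by rewrite /= -exp_0; congr exp; field.
      rewrite S_INR [LHS]/= IH -exp_plus; congr exp; field.
    rewrite -exp_plus; case: (Req_dec (- (v / 2)) (1 / 2 + - (u * INR i.+1 / 2))) => [->|hne].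
      exact: Rle_refl.
    left; apply: exp_increasing; lra.
  have := exp_half_le2; have := pow_lt x i.+1 (proj1 hx); nra.
apply: Rle_trans (Rsum_le _ (G := fun i : 'I_N => 432 / (u ^ k) ^ j * x * x ^ i) _) _.
  by move=> i _; exact: h1.
rewrite -Rsum_distrr.
have hg : \big[Rplus/0]_(i < N) x ^ i <= / (1 - x) by apply: geometric_sum_le; lra.
have hxx : x * / (1 - x) <= 2 / u.
  apply: (Rmult_le_reg_r (1 - x)); first lra.
  have -> : x * / (1 - x) * (1 - x) = x by field; lra.
  apply: (Rmult_le_reg_r u) => //.
  have -> : 2 / u * (1 - x) * u = 2 * (1 - x) by field; lra.
  have : x * (1 + u / 2) <= 1.
    rewrite /x exp_Ropp; have h := exp_ineq1_le (u / 2); have h0 := exp_pos (u / 2).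
    apply: (Rmult_le_reg_l (exp (u / 2))) => //.
    rewrite -Rmult_assoc Rinv_r; lra.
  lra.
have hc : 0 < 432 / (u ^ k) ^ j by apply: Rdiv_lt_0_compat; lra.
have -> : 864 / ((u ^ k) ^ j * u) = 432 / (u ^ k) ^ j * (2 / u) by field; lra.
rewrite Rmult_assoc; apply: Rmult_le_compat_l; first lra.
apply: Rle_trans hxx; apply: Rmult_le_compat_l => //; lra.
Qed.

Lemma ex_series_part_moment k u j : (0 < k)%N -> 0 < u -> (j <= 3)%N ->
  ex_series (part_moment k u j).
Proof.
move=> hk hu hj; apply: ex_series_bounded => [i|n]; first exact: part_moment_ge0.
exact: part_moment_partial_le.
Qed.

Lemma Series_part_moment_le k u j : (0 < k)%N -> 0 < u -> (j <= 3)%N ->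
  Series (part_moment k u j) <= 864 / ((u ^ k) ^ j * u).
Proof.
move=> hk hu hj; apply: Series_bounded => [i|n]; first exact: part_moment_ge0.
exact: part_moment_partial_le.
Qed.

Lemma Series_part_moment_ge0 k u j : (0 < k)%N -> 0 < u -> (j <= 3)%N ->
  0 <= Series (part_moment k u j).
Proof.
move=> hk hu hj.
have := big_le_Series 0 (fun i => part_moment_ge0 k j i hu) (ex_series_part_moment hk hu hj).
by rewrite big_ord0.
Qed.

Definition exp_point (k : nat) (u phi : R) : C := (exp (- u ^ k) * expi phi)%C.

Lemma exp_pow x n : exp x ^ n = exp (INR n * x).
Proof.
elim: n => [|n IH]; first by rewrite /= Rmult_0_l exp_0.
by rewrite S_INR [LHS]/= IH -exp_plus; congr exp; ring.
Qed.

Lemma expi_pow x n : (expi x ^ n)%C = expi (INR n * x).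
Proof.
elim: n => [|n IH]; first by rewrite /= Rmult_0_l expi_0.
by rewrite Cpow_S IH -expi_plus; congr expi; rewrite S_INR; ring.
Qed.

Lemma exp_point_pow k u phi i :
  (exp_point k u phi ^ (i.+1 ^ k)%N)%C = (part_prob k u i * expi (part_weight k i * phi)%coqR)%C.
Proof.
rewrite /exp_point Cpow_mult_l -RtoC_pow exp_pow expi_pow INR_expn /part_prob /part_weight.
congr (RtoC (exp _) * _)%C; rewrite Rpow_mult_distr; ring.
Qed.

Lemma Cmod_exp_point k u phi : Cmod (exp_point k u phi) = exp (- u ^ k).
Proof.
rewrite /exp_point Cmod_mult Cmod_expi Cmod_R Rabs_pos_eq; first ring.
by left; exact: exp_pos.
Qed.

Lemma Cmod_exp_point_lt1 k u phi : 0 < u -> Cmod (exp_point k u phi) < 1.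
Proof.
by move=> hu; rewrite Cmod_exp_point; have := exp_lt1 (pow_lt u k hu); lra.
Qed.

(** The characteristic function of the contribution of the first N parts. *)
Definition cf_partial k u N phi : C :=
  \big[Cmult/RtoC 1]_(i < N)
     ((1 - part_prob k u i) / (1 - part_prob k u i * expi (part_weight k i * phi)%coqR))%C.

Definition partition_cf k u phi : C :=
  (partition_gf k (exp_point k u phi) / PSeries (power_partition_series k) (exp (- u ^ k)))%C.

Lemma one_sub_neq0 (z : C) : Cmod z < 1 -> (1 - z)%C <> 0.
Proof.
move=> hx h; have e : z = 1 by rewrite -[z]Cplus_0_l -h; ring.
by move: hx; rewrite e Cmod_1; lra.
Qed.

Lemma Cmod_prob_expi k u i x : 0 < u -> Cmod (part_prob k u i * expi x)%C < 1.
Proof.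
move=> hu; have h := part_prob_lt1 k i hu.
rewrite Cmod_mult Cmod_expi Cmod_R Rabs_pos_eq; lra.
Qed.

Lemma PSeries_partition_pos k t : (0 < k)%N -> 0 <= t < 1 ->
  0 < PSeries (power_partition_series k) t.
Proof.
move=> hk ht; apply: (Rlt_le_trans _ (\big[Rplus/0]_(n < 1) (power_partition_series k n * t ^ n))).
  by rewrite big_ord1 /= Rmult_1_r; exact: power_partition_series_pos.
apply: big_le_Series => [n|]; last exact: ex_series_partition.
apply: Rmult_le_pos; [left; exact: power_partition_series_pos | apply: pow_le; lra].
Qed.

Lemma partition_gf_real k t : (0 < k)%N -> 0 <= t < 1 ->
  partition_gf k (RtoC t) = RtoC (PSeries (power_partition_series k) t).
Proof.
move=> hk ht; rewrite /partition_gf /RtoC /PSeries; congr pair.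
  by apply: Series_ext => n; rewrite -[(t, 0)]/(RtoC t) -RtoC_pow.
transitivity (Series (fun n => power_partition_series k n * 0)).
  by apply: Series_ext => n; rewrite -[(t, 0)]/(RtoC t) -RtoC_pow.
by rewrite Series_scal_r Rmult_0_r.
Qed.

Lemma is_Clim_seq_RtoC (x : nat -> R) (l : R) :
  is_lim_seq x l -> is_Clim_seq (fun n => RtoC (x n)) (RtoC l).
Proof.
move=> h; apply: (is_lim_seq_ext (fun n => Rabs (x n - l))).
  by move=> n; rewrite -RtoC_minus Cmod_R.
have -> : Finite 0 = Finite (Rabs (l - l)) by rewrite Rminus_diag Rabs_R0.
apply: (is_lim_seq_abs _ (Finite (l - l))); apply: is_lim_seq_minus' => //.
exact: is_lim_seq_const.
Qed.

(** Both the numerator, at t exp(i phi), and the denominator, at t, are limits of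
    the finite products. *)
Lemma cf_partial_lim k u phi : (0 < k)%N -> 0 < u ->
  is_Clim_seq (fun N => cf_partial k u N phi) (partition_cf k u phi).
Proof.
move=> hk hu; set t := exp (- u ^ k).
have ht : 0 < t < 1 by apply: exp_lt1; exact: pow_lt.
have hz := power_product_lim hk (Cmod_exp_point_lt1 k phi hu).
have e0 : RtoC t = exp_point k u 0 by rewrite /exp_point expi_0 Cmult_1_r.
have h0 := power_product_lim hk (Cmod_exp_point_lt1 k 0 hu).
rewrite -e0 partition_gf_real // in h0; last lra.
pose f N := \big[Rmult/1]_(i < N) (/ (1 - part_prob k u i)).
have ef N : power_partial_product k (RtoC t) N = RtoC (f N).
  rewrite power_partial_productE e0 /f RtoC_prod; apply: eq_bigr => i _.
  have h := part_prob_lt1 k i hu.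
  rewrite exp_point_pow Rmult_0_r expi_0 Cmult_1_r RtoC_inv; last lra.
  by rewrite RtoC_minus /Cdiv Cmult_1_l.
have hf : is_lim_seq f (PSeries (power_partition_series k) t).
  have -> : Finite (PSeries (power_partition_series k) t) = Finite (0 + PSeries (power_partition_series k) t) by congr Finite; ring.
  apply: (is_lim_seq_ext (fun N => (f N - PSeries (power_partition_series k) t) + PSeries (power_partition_series k) t)).
    by move=> n; ring.
  apply: is_lim_seq_plus'; last exact: is_lim_seq_const.
  apply/is_lim_seq_abs_0; apply: is_lim_seq_ext h0 => N.
  by rewrite ef -RtoC_minus Cmod_R.
have hfp : 0 < PSeries (power_partition_series k) t by apply: PSeries_partition_pos => //; lra.
have hfi : is_lim_seq (fun N => / f N) (/ PSeries (power_partition_series k) t).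
  by apply: (is_lim_seq_inv _ _ hf) => -[]; lra.
have := is_Clim_seq_mult hz (is_Clim_seq_RtoC hfi).
rewrite RtoC_inv; last lra.
apply: is_lim_seq_ext => N; congr Cmod; congr Cminus.
rewrite power_partial_productE /f /cf_partial.
have -> : / (\big[Rmult/1]_(i < N) (/ (1 - part_prob k u i))) = \big[Rmult/1]_(i < N) (1 - part_prob k u i).
  apply: (big_ind2 (fun x y => / x = y)) => [|x a y b <- <-|i _]; first by rewrite Rinv_1.
    by rewrite Rinv_mult.
  by rewrite Rinv_inv.
rewrite RtoC_prod -big_split; apply: eq_bigr => i _ /=.
rewrite exp_point_pow RtoC_minus; field.
by apply: one_sub_neq0; exact: Cmod_prob_expi.
Qed.

(** * Gaussian approximation on the major arc *)

Lemma expi_sum (I : Type) (r : seq I) (P : pred I) (F : I -> R) :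
  expi (\big[Rplus/0]_(i <- r | P i) F i) = \big[Cmult/RtoC 1]_(i <- r | P i) expi (F i).
Proof. by apply: big_morph; [exact: expi_plus | exact: expi_0]. Qed.

Lemma expi_neq0 x : expi x <> 0.
Proof. by apply/Cmod_gt_0; rewrite Cmod_expi; lra. Qed.

Lemma expiN x : expi (- x) = (/ expi x)%C.
Proof.
have h : (expi (- x) * expi x)%C = 1 by rewrite -expi_plus Rplus_opp_l expi_0.
have nz := @expi_neq0 x.
by rewrite -[expi (- x)]Cmult_1_r -(Cinv_r (expi x)) // Cmult_assoc h Cmult_1_l.
Qed.

Lemma is_Clim_seq_expi (x : nat -> R) (l : R) :
  is_lim_seq x l -> is_Clim_seq (fun n => expi (x n)) (expi l).
Proof.
move=> h; apply: (@is_lim_seq_squeeze0 _ (fun n => Rabs (x n - l))).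
  move=> n; split; first exact: Cmod_ge_0.
  have -> : (expi (x n) - expi l = (expi (x n - l) - 1) * expi l)%C.
    rewrite /Rminus expi_plus expiN; field; exact: expi_neq0.
  by rewrite Cmod_mult Cmod_expi Rmult_1_r; exact: Cmod_expi_sub1.
have -> : Finite 0 = Finite (Rabs (l - l)) by rewrite Rminus_diag Rabs_R0.
apply: (is_lim_seq_abs _ (Finite (l - l))); apply: is_lim_seq_minus' => //.
exact: is_lim_seq_const.
Qed.

Lemma exp_le x y : x <= y -> exp x <= exp y.
Proof. by case=> [h|->]; [left; exact: exp_increasing | exact: Rle_refl]. Qed.

Lemma RtoC_neq0 x : x <> 0 -> RtoC x <> 0.
Proof. by move=> h /RtoC_inj. Qed.

(** Inverting factor by factor brings the expression into the form treated by
    [geometric_factor_approx]. *)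
Lemma cf_partial_gaussian k u N phi : 0 < u ->
  (cf_partial k u N phi *
    (expi (- (phi * \big[Rplus/0]_(i < N) part_moment k u 1 i))%coqR *
     exp (phi ^ 2 / 2 * \big[Rplus/0]_(i < N) part_moment k u 2 i)%coqR))%C =
  (/ \big[Cmult/RtoC 1]_(i < N)
    ((1 - part_prob k u i * expi (part_weight k i * phi)%coqR) / (1 - part_prob k u i) *
      (expi (part_prob k u i / (1 - part_prob k u i) * (part_weight k i * phi))%coqR *
       exp (- (part_prob k u i / (1 - part_prob k u i) ^ 2 * (part_weight k i * phi) ^ 2 / 2))%coqR)))%C.
Proof.
move=> hu.
rewrite expiN !Rsum_distrr expi_sum exp_sum RtoC_prod /cf_partial.
have hinv (F : 'I_N -> C) : (forall i, F i <> 0) ->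
  (/ (\big[Cmult/RtoC 1]_(i < N) F i) = \big[Cmult/RtoC 1]_(i < N) (/ F i))%C /\
  \big[Cmult/RtoC 1]_(i < N) F i <> 0.
  move=> hF; apply: (big_ind2 (fun x y => (/ x)%C = y /\ x <> 0)) => //.
  - by split; [rewrite -RtoC_inv ?Rinv_1 //; lra | apply: RtoC_neq0; lra].
  - move=> x a y b [<- h1] [<- h2]; split; last exact: Cmult_neq_0.
    by field.
rewrite (proj1 (hinv (fun i => expi (phi * part_moment k u 1 i)) _)); last by move=> i; exact: expi_neq0.
have h1 i : (1 - part_prob k u i * expi (part_weight k i * phi)%coqR)%C <> 0.
  by apply: one_sub_neq0; exact: Cmod_prob_expi.
have h2 i : (1 - part_prob k u i)%C <> 0.
  rewrite -RtoC_minus; apply: RtoC_neq0; have := part_prob_lt1 k i hu; lra.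
have h3 x : RtoC (exp x) <> 0 by apply: RtoC_neq0; have := exp_pos x; lra.
rewrite (proj1 (hinv _ _)); last first.
  move=> i; apply: Cmult_neq_0.
    apply: Cmult_neq_0 => // h.
    by apply: (RtoC_neq0 R1_neq_R0); rewrite -(Cinv_r _ (h2 i)) h Cmult_0_r.
  by apply: Cmult_neq_0 => //; exact: expi_neq0.
rewrite -!big_split; apply: eq_bigr => i _ /=.
have hq := part_prob_lt1 k i hu.
have -> : part_prob k u i / (1 - part_prob k u i) * (part_weight k i * phi) = phi * part_moment k u 1 i.
  by rewrite /part_moment pow_1; field; lra.
have -> : part_prob k u i / (1 - part_prob k u i) ^ 2 * (part_weight k i * phi) ^ 2 / 2 = phi ^ 2 / 2 * part_moment k u 2 i.
  by rewrite /part_moment; field; lra.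
rewrite exp_Ropp RtoC_inv; last by have := exp_pos (phi ^ 2 / 2 * part_moment k u 2 i); lra.
rewrite -[phi * (phi * 1)]/(phi ^ 2); field; repeat split; try exact: expi_neq0; try exact: h1; try exact: h2; exact: h3.
Qed.

(** The errors 6 q_n (n^k |phi| / (1 - q_n))^3 add up to 6 |phi|^3 K for every
    partial product; the estimate then passes to the limit. *)
Lemma major_arc k u phi (e := exp (6 * (Rabs phi ^ 3 * Series (part_moment k u 3))) - 1) :
  (0 < k)%N -> 0 < u -> e < 1 ->
  Cmod (partition_cf k u phi *
    (expi (- (phi * Series (part_moment k u 1)))%coqR *
     exp (phi ^ 2 / 2 * Series (part_moment k u 2))%coqR) - 1)%C <= e / (1 - e).
Proof.
move=> hk hu he.
have hlim j : (j <= 3)%N -> is_lim_seq (fun N => \big[Rplus/0]_(i < N) part_moment k u j i) (Series (part_moment k u j)).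
  by move=> hj; apply: is_series_big; apply: Series_correct; exact: ex_series_part_moment.
have h1 : is_Clim_seq (fun N => cf_partial k u N phi *
    (expi (- (phi * \big[Rplus/0]_(i < N) part_moment k u 1 i))%coqR *
     exp (phi ^ 2 / 2 * \big[Rplus/0]_(i < N) part_moment k u 2 i)%coqR))%C (partition_cf k u phi *
    (expi (- (phi * Series (part_moment k u 1)))%coqR *
     exp (phi ^ 2 / 2 * Series (part_moment k u 2))%coqR))%C.
  apply: is_Clim_seq_mult; first exact: cf_partial_lim.
  apply: is_Clim_seq_mult.
    apply: is_Clim_seq_expi; apply/is_lim_seq_opp.
    apply: (is_lim_seq_ext (fun n => - - (phi * \big[Rplus/0]_(i < n) part_moment k u 1 i))).
      by move=> n.
    rewrite /Rbar_opp Ropp_involutive.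
    apply: (is_lim_seq_ext (fun n => (phi * \big[Rplus/0]_(i < n) part_moment k u 1 i))).
      by move=> n; rewrite Ropp_involutive.
    apply: is_lim_seq_mult'; [exact: is_lim_seq_const | exact: hlim].
  apply: is_Clim_seq_RtoC.
  apply: (is_lim_seq_continuous exp); first by apply: derivable_continuous_pt; exact: derivable_pt_exp.
  apply: is_lim_seq_mult'; [exact: is_lim_seq_const | exact: hlim].
apply: (is_Clim_seq_Cmod_le h1); exists 0%N => N _.
rewrite cf_partial_gaussian //; apply: Cmod_inv_sub1 => //.
eapply Rle_trans.
  apply: (@prod_near_one _ _ _ (fun i : 'I_N => 6 * Rabs phi ^ 3 * part_moment k u 3 i)) => i.
  have hq := part_prob_lt1 k i hu.
  apply: Rle_trans (geometric_factor_approx (part_weight k i * phi) hq) _.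
  apply: Req_le; rewrite Rabs_mult (Rabs_pos_eq (part_weight k i)).
    by rewrite /part_moment; field; lra.
  by have := part_weight_ge1 k i; lra.
rewrite -Rsum_distrr; apply: Rplus_le_compat_r; apply: exp_le.
rewrite -Rmult_assoc; apply: Rmult_le_compat_l.
  by apply: Rmult_le_pos; [lra | apply: pow_le; exact: Rabs_pos].
apply: big_le_Series; last exact: ex_series_part_moment.
by move=> i; exact: part_moment_ge0.
Qed.

(** * Mean and variance *)

(** From x / j <= exp(x / j); for j = 0 it holds because INR 0 ^ 0 = 1. *)
Lemma pow_le_exp x j : 0 <= x -> x ^ j <= INR j ^ j * exp x.
Proof.
move=> hx; case: j => [|j].
  by rewrite /= Rmult_1_l; have := exp_ineq1_le x; lra.
have hj : 0 < INR j.+1 by apply: lt_0_INR; lia.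
have -> : x ^ j.+1 = INR j.+1 ^ j.+1 * (x / INR j.+1) ^ j.+1.
  by rewrite -Rpow_mult_distr; congr (_ ^ _); field; lra.
apply: Rmult_le_compat_l; first by apply: pow_le; lra.
apply: Rle_trans (_ : exp (x / INR j.+1) ^ j.+1 <= _).
  apply: pow_incr; split; first by apply: Rdiv_le_0_compat.
  by have := exp_ineq1_le (x / INR j.+1); lra.
by rewrite exp_pow; apply: Req_le; congr exp; field; lra.
Qed.

Lemma Rabs_cos_le1 x : Rabs (cos x) <= 1.
Proof. by apply: Rabs_le; have := COS_bound x; lra. Qed.

Lemma Rabs_sin_le1 x : Rabs (sin x) <= 1.
Proof. by apply: Rabs_le; have := SIN_bound x; lra. Qed.

Lemma Series_Rabs_le (f g : nat -> R) :
  (forall n, Rabs (f n) <= g n) -> ex_series g -> Rabs (Series f) <= Series g.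
Proof.
move=> h hg; apply: Rle_trans (Series_Rabs _ _) _.
  by apply: ex_series_le hg => n; rewrite /norm /= /abs /= Rabs_Rabsolu.
by apply: Series_le => // n; split; [exact: Rabs_pos | exact: h].
Qed.

Lemma exp_sub_affine y : 0 <= y -> 0 <= exp (- y) - (1 - y) <= y ^ 2.
Proof.
move=> hy; have h1 := exp_ineq1_le (- y); split; first lra.
have h2 := exp_ineq1_le y.
have : exp (- y) * (1 + y) <= 1.
  rewrite exp_Ropp; have h0 := exp_pos y.
  apply: (Rmult_le_reg_l (exp y)) => //.
  rewrite -Rmult_assoc Rinv_r; lra.
case: (Rle_lt_dec y 1) => h; last first.
  have : exp (- y) <= 1 by rewrite -exp_0; apply: exp_le; lra.
  nra.
have := exp_pos (- y); nra.
Qed.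

Lemma exp_le_double x : 0 <= x <= 1 / 2 -> exp x - 1 <= 2 * x.
Proof.
move=> hx; have h := exp_ineq1_le (- x); have := exp_pos x.
have : exp x * exp (- x) = 1 by rewrite -exp_plus Rplus_opp_r exp_0.
nra.
Qed.

(** The uniqueness of Taylor coefficients, for the second one. *)
Lemma eq0_of_cubic_bound (X c phi0 : R) : 0 < phi0 -> 0 <= c ->
  (forall phi, 0 < phi <= phi0 -> Rabs (X * phi ^ 2) <= c * phi ^ 3) -> X = 0.
Proof.
move=> h0 hc h; case: (Req_dec X 0) => // hX.
have hXp : 0 < Rabs X by exact: Rabs_pos_lt.
set phi := Rmin phi0 (Rabs X / (2 * (c + 1))).
have hp : 0 < Rabs X / (2 * (c + 1)) by apply: Rdiv_lt_0_compat; lra.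
have h1 : 0 < phi <= phi0 by split; [exact: Rmin_pos | exact: Rmin_l].
have h2 : phi * (2 * (c + 1)) <= Rabs X.
  apply: (Rle_trans _ (Rabs X / (2 * (c + 1)) * (2 * (c + 1)))).
    by apply: Rmult_le_compat_r; [lra | exact: Rmin_r].
  by apply: Req_le; field; lra.
have := h phi h1; rewrite Rabs_mult (Rabs_pos_eq (phi ^ 2)); last exact: pow2_ge_0.
have h3 : 0 < phi ^ 2 by apply: pow_lt; lra.
have -> : c * phi ^ 3 = (c * phi) * phi ^ 2 by ring.
move/(Rmult_le_reg_r _ _ _ h3); nra.
Qed.

Definition partition_prob (k : nat) (u : R) : nat -> R :=
  khinchin_prob (power_partition_series k) (exp (- u ^ k)).

Section Moments.
Variables (k : nat) (u : R).
Hypotheses (hk : (0 < k)%N) (hu : 0 < u).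

Let t := exp (- u ^ k).
Let p := partition_prob k u.

Lemma exp_radius_bounds : 0 < t < 1.
Proof. by apply: exp_lt1; exact: pow_lt. Qed.

Lemma PSeries_radius_pos : 0 < PSeries (power_partition_series k) t.
Proof. by apply: PSeries_partition_pos => //; have := exp_radius_bounds; lra. Qed.

Lemma partition_prob_ge0 n : 0 <= p n.
Proof.
rewrite /p /partition_prob /khinchin_prob -/t; apply: Rdiv_le_0_compat; last exact: PSeries_radius_pos.
apply: Rmult_le_pos; first by left; exact: power_partition_series_pos.
by apply: pow_le; have := exp_radius_bounds; lra.
Qed.

(** Splitting t^n into two factors exp(-n d), one absorbs n^j and the other keeps
    the power series inside its disk of convergence. *)
Lemma ex_series_moment j : ex_series (fun n => INR n ^ j * p n).
Proof.
set d := u ^ k / 2.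
have hs : 0 < u ^ k by exact: pow_lt.
have hd : 0 < d by rewrite /d; lra.
have hr := exp_lt1 hd; have hF := PSeries_radius_pos.
set c := INR j ^ j / d ^ j / PSeries (power_partition_series k) t.
apply: (ex_series_le _ (fun n => c * (power_partition_series k n * exp (- d) ^ n))).
  move=> n; rewrite /norm /= /abs /= Rabs_pos_eq; last first.
    by apply: Rmult_le_pos; [apply: pow_le; exact: pos_INR | exact: partition_prob_ge0].
  rewrite /p /partition_prob /khinchin_prob -/t.
  have et : t ^ n = exp (- d) ^ n * exp (- (INR n * d)).
    by rewrite /t !exp_pow -exp_plus; congr exp; rewrite /d; field.
  have h : INR n ^ j * exp (- (INR n * d)) <= INR j ^ j / d ^ j.
    apply: (Rmult_le_reg_r (d ^ j)); first exact: pow_lt.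
    have -> : INR j ^ j / d ^ j * d ^ j = INR j ^ j by field; apply: pow_nonzero; lra.
    have := pow_le_exp j (Rmult_le_pos _ _ (pos_INR n) (Rlt_le _ _ hd)).
    rewrite Rpow_mult_distr => h.
    apply: (Rmult_le_reg_r (exp (INR n * d))); first exact: exp_pos.
    apply: Rle_trans h; apply: Req_le; rewrite exp_Ropp; field.
    by have := exp_pos (INR n * d); lra.
  have -> : c * (power_partition_series k n * exp (- d) ^ n) =
     INR j ^ j / d ^ j * (power_partition_series k n * exp (- d) ^ n / PSeries (power_partition_series k) t).
    by rewrite /c; field; split; try apply: pow_nonzero; lra.
  rewrite et.
  have -> : INR n ^ j * (power_partition_series k n * (exp (- d) ^ n * exp (- (INR n * d))) / PSeries (power_partition_series k) t)
   = (INR n ^ j * exp (- (INR n * d))) * (power_partition_series k n * exp (- d) ^ n / PSeries (power_partition_series k) t).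
    by field; lra.
  apply: Rmult_le_compat_r => //.
  apply: Rdiv_le_0_compat => //; apply: Rmult_le_pos; last by apply: pow_le; lra.
  by left; exact: power_partition_series_pos.
by apply: (ex_series_scal c); apply: ex_series_partition => //; lra.
Qed.

Definition raw_moment j := Series (fun n => INR n ^ j * p n).

Lemma raw_moment0 : raw_moment 0 = 1.
Proof.
rewrite /raw_moment /p /partition_prob /khinchin_prob -/t.
have hF := PSeries_radius_pos.
rewrite (Series_ext _ (fun n => power_partition_series k n * t ^ n * / PSeries (power_partition_series k) t)).
  by rewrite Series_scal_r -[Series _]/(PSeries (power_partition_series k) t) Rinv_r //; lra.
by move=> n; rewrite Rmult_1_l.
Qed.

Lemma ex_series_trig (g : nat -> R) : (forall n, Rabs (g n) <= 1) -> ex_series (fun n => g n * p n).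
Proof.
move=> hg; apply: (ex_series_le _ (fun n => INR n ^ 0 * p n)); last exact: ex_series_moment.
move=> n; rewrite /norm /= /abs /= Rabs_mult (Rabs_pos_eq (p n)); last exact: partition_prob_ge0.
apply: Rmult_le_compat_r => //; exact: partition_prob_ge0.
Qed.

Lemma partition_cf_coords phi : partition_cf k u phi =
  (Series (fun n => cos (INR n * phi) * p n), Series (fun n => sin (INR n * phi) * p n)).
Proof.
have hF := PSeries_radius_pos.
have e n : (exp_point k u phi ^ n)%C = (t ^ n * cos (INR n * phi), t ^ n * sin (INR n * phi)).
  rewrite /exp_point Cpow_mult_l -RtoC_pow expi_pow -/t /expi /RtoC /Cmult /=.
  by congr pair; ring.
rewrite /partition_cf -/t /Cdiv -RtoC_inv; last lra.
rewrite /partition_gf {1}/RtoC /Cmult /=; congr pair.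
  rewrite Rmult_0_r Rminus_0_r -Series_scal_r; apply: Series_ext => n.
  by rewrite e /p /partition_prob /khinchin_prob -/t /=; field; lra.
rewrite Rmult_0_r Rplus_0_l -Series_scal_r; apply: Series_ext => n.
by rewrite e /p /partition_prob /khinchin_prob -/t /=; field; lra.
Qed.

Lemma cf_re_taylor phi :
  Rabs (Re (partition_cf k u phi) - (1 - phi ^ 2 / 2 * raw_moment 2)) <= Rabs phi ^ 3 * raw_moment 3.
Proof.
have hs : ex_series (fun n => phi ^ 2 / 2 * (INR n ^ 2 * p n)).
  by apply: (ex_series_scal (phi ^ 2 / 2)); exact: ex_series_moment.
have h0 := ex_series_moment 0.
have hm : ex_series (fun n => INR n ^ 0 * p n - phi ^ 2 / 2 * (INR n ^ 2 * p n)).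
  exact: (ex_series_minus (V := R_NormedModule) _ _ h0 hs).
have hc : ex_series (fun n => cos (INR n * phi) * p n).
  by apply: ex_series_trig => n; exact: Rabs_cos_le1.
rewrite partition_cf_coords /Re /fst -{1}raw_moment0 /raw_moment -!Series_scal_l -!Series_minus //.
apply: Series_Rabs_le; last by apply: ex_series_scal; exact: ex_series_moment.
move=> n.
have -> : cos (INR n * phi) * p n - (INR n ^ 0 * p n - phi ^ 2 / 2 * (INR n ^ 2 * p n)) =
  (cos (INR n * phi) - (1 - (INR n * phi) ^ 2 / 2)) * p n by field.
rewrite Rabs_mult (Rabs_pos_eq (p n)); last exact: partition_prob_ge0.
rewrite -Rmult_assoc; apply: Rmult_le_compat_r; first exact: partition_prob_ge0.
apply: Rle_trans (cos_taylor2 _) _.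
rewrite Rabs_mult (Rabs_pos_eq (INR n)); last exact: pos_INR.
have := pow_le _ 3 (Rabs_pos phi); have := pow_le _ 3 (pos_INR n); rewrite Rpow_mult_distr; nra.
Qed.

Lemma cf_im_taylor phi :
  Rabs (Im (partition_cf k u phi) - phi * raw_moment 1) <= Rabs phi ^ 3 * raw_moment 3.
Proof.
have h1 : ex_series (fun n => phi * (INR n ^ 1 * p n)).
  by apply: (ex_series_scal phi); exact: ex_series_moment.
have hs : ex_series (fun n => sin (INR n * phi) * p n).
  by apply: ex_series_trig => n; exact: Rabs_sin_le1.
rewrite partition_cf_coords /Im /snd /raw_moment -!Series_scal_l -!Series_minus //.
apply: Series_Rabs_le; last by apply: ex_series_scal; exact: ex_series_moment.
move=> n.
have -> : sin (INR n * phi) * p n - phi * (INR n ^ 1 * p n) =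
  (sin (INR n * phi) - (INR n * phi)) * p n by ring.
rewrite Rabs_mult (Rabs_pos_eq (p n)); last exact: partition_prob_ge0.
rewrite -Rmult_assoc; apply: Rmult_le_compat_r; first exact: partition_prob_ge0.
apply: Rle_trans (sin_taylor1 _) _.
rewrite Rabs_mult (Rabs_pos_eq (INR n)); last exact: pos_INR.
have := pow_le _ 3 (Rabs_pos phi); have := pow_le _ 3 (pos_INR n); rewrite Rpow_mult_distr; nra.
Qed.

Let A := Series (part_moment k u 1).
Let B := Series (part_moment k u 2).
Let K := Series (part_moment k u 3).

Lemma cf_near_gaussian phi : 0 <= phi -> 6 * (phi ^ 3 * K) <= 1 / 4 ->
  Cmod (partition_cf k u phi - expi (phi * A)%coqR * exp (- (phi ^ 2 / 2 * B))%coqR)%C <= 24 * (phi ^ 3 * K).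
Proof.
move=> hphi hsm.
have hB : 0 <= B by exact: Series_part_moment_ge0.
have hK : 0 <= K by exact: Series_part_moment_ge0.
have h3 : 0 <= phi ^ 3 by exact: pow_le.
have h3K : 0 <= phi ^ 3 * K by exact: Rmult_le_pos.
set e := exp (6 * (Rabs phi ^ 3 * K)) - 1.
have he : 0 <= e <= 12 * (phi ^ 3 * K).
  rewrite /e (Rabs_pos_eq phi) //; split; first by have := exp_ineq1_le (6 * (phi ^ 3 * K)); lra.
  have := @exp_le_double (6 * (phi ^ 3 * K)); lra.
have he1 : e < 1 by lra.
have h := major_arc hk hu he1.
rewrite -/A -/B in h.
set H := (expi (- (phi * A))%coqR * exp (phi ^ 2 / 2 * B)%coqR)%C in h.
have -> : (partition_cf k u phi - expi (phi * A)%coqR * exp (- (phi ^ 2 / 2 * B))%coqR =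
  (partition_cf k u phi * H - 1) * (expi (phi * A)%coqR * exp (- (phi ^ 2 / 2 * B))%coqR))%C.
  rewrite /H expiN exp_Ropp RtoC_inv; last by have := exp_pos (phi ^ 2 / 2 * B); lra.
  field; split; last exact: expi_neq0.
  by apply: RtoC_neq0; have := exp_pos (phi ^ 2 / 2 * B); lra.
rewrite !Cmod_mult Cmod_expi Cmod_R Rmult_1_l Rabs_pos_eq; last by left; exact: exp_pos.
have h1 : exp (- (phi ^ 2 / 2 * B)) <= 1.
  rewrite -exp_0; apply: exp_le; have := pow2_ge_0 phi; nra.
have h2 : e / (1 - e) <= 24 * (phi ^ 3 * K).
  apply: (Rmult_le_reg_r (1 - e)); first lra.
  have -> : e / (1 - e) * (1 - e) = e by field; lra.
  nra.
have := Cmod_ge_0 (partition_cf k u phi * H - 1)%C.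
have := exp_pos (- (phi ^ 2 / 2 * B)).
have : Cmod (partition_cf k u phi * H - 1)%C <= e / (1 - e) by exact: h.
nra.
Qed.

Lemma gaussian_taylor phi : 0 <= phi <= 1 ->
  Rabs (exp (- (phi ^ 2 / 2 * B)) * cos (phi * A) - (1 - phi ^ 2 / 2 * (B + A ^ 2)))
    <= (B ^ 2 + (1 + B) * A ^ 3 + B * A ^ 2) * phi ^ 3 /\
  Rabs (exp (- (phi ^ 2 / 2 * B)) * sin (phi * A) - phi * A)
    <= (A * B + A ^ 3) * phi ^ 3.
Proof.
move=> hphi.
have hA : 0 <= A by exact: Series_part_moment_ge0.
have hB : 0 <= B by exact: Series_part_moment_ge0.
set x := phi * A; set y := phi ^ 2 / 2 * B.
have h2 : 0 <= phi ^ 2 by exact: pow2_ge_0.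
have hy : 0 <= y by rewrite /y; nra.
have hx : 0 <= x by rewrite /x; nra.
have he := exp_sub_affine hy.
have hc := cos_taylor2 x; have hs := sin_taylor1 x.
rewrite (Rabs_pos_eq x) // in hc hs.
have h3 : 0 <= phi ^ 3 by apply: pow_le; lra.
have h43 : phi ^ 4 <= phi ^ 3 by have -> : phi ^ 4 = phi * phi ^ 3 by [ring]; nra.
have hx3 : x ^ 3 = A ^ 3 * phi ^ 3 by rewrite /x; ring.
have hA3 : 0 <= A ^ 3 by exact: pow_le.
have hA2 : 0 <= A ^ 2 by exact: pow_le.
have hB2 : 0 <= B ^ 2 by exact: pow_le.
have hy1 : y <= B by rewrite /y; nra.
have hy2 : y ^ 2 <= B ^ 2 * phi ^ 3.
  have -> : y ^ 2 = B ^ 2 * phi ^ 4 / 4 by rewrite /y; field.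
  have : 0 <= phi ^ 4 by apply: pow_le; lra.
  nra.
split.
  have -> : exp (- y) * cos x - (1 - phi ^ 2 / 2 * (B + A ^ 2)) =
    (exp (- y) - (1 - y)) * cos x + ((1 - y) * (cos x - (1 - x ^ 2 / 2)) + B * A ^ 2 / 4 * phi ^ 4).
    by rewrite /x /y; field.
  apply: Rle_trans (Rabs_triang _ _) _.
  apply: Rle_trans (Rplus_le_compat_l _ _ _ (Rabs_triang _ _)) _.
  rewrite (Rabs_mult _ (cos x)) (Rabs_mult (1 - y)) (Rabs_mult (B * A ^ 2 / 4)) (Rabs_pos_eq (exp _ - _)); last lra.
  have t1 : (exp (- y) - (1 - y)) * Rabs (cos x) <= B ^ 2 * phi ^ 3.
    have := Rabs_cos_le1 x; have := Rabs_pos (cos x); nra.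
  have t2 : Rabs (1 - y) * Rabs (cos x - (1 - x ^ 2 / 2)) <= (1 + B) * (A ^ 3 * phi ^ 3).
    apply: Rmult_le_compat; try exact: Rabs_pos.
      by apply: Rabs_le; lra.
    apply: Rle_trans hc _; rewrite hx3.
    have : 0 <= A ^ 3 * phi ^ 3 by apply: Rmult_le_pos.
    lra.
  have t3 : Rabs (B * A ^ 2 / 4) * Rabs (phi ^ 4) <= B * A ^ 2 * phi ^ 3.
    have hBA : 0 <= B * A ^ 2 by exact: Rmult_le_pos.
    rewrite (Rabs_pos_eq (phi ^ 4)); last by apply: pow_le; lra.
    rewrite Rabs_pos_eq; last lra.
    nra.
  lra.
have -> : exp (- y) * sin x - x = (exp (- y) - 1) * sin x + (sin x - x) by ring.
apply: Rle_trans (Rabs_triang _ _) _.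
rewrite Rabs_mult.
have t1 : Rabs (exp (- y) - 1) <= y.
  have : exp (- y) <= 1 by rewrite -exp_0; apply: exp_le; lra.
  by move=> h; apply: Rabs_le; lra.
have t2 : Rabs (sin x) <= x.
  have := sin_le_self hx; have := sin_taylor_nonneg hx.
  case: (Rle_lt_dec x 1) => h; last by have := Rabs_sin_le1 x; lra.
  have : 0 <= x ^ 3 <= x by have := pow2_ge_0 x; rewrite -[x ^ 3]/(x * x ^ 2) /=; nra.
  by move=> *; apply: Rabs_le; lra.
have t3 : Rabs (exp (- y) - 1) * Rabs (sin x) <= y * x.
  by apply: Rmult_le_compat => //; exact: Rabs_pos.
have -> : (A * B + A ^ 3) * phi ^ 3 = A * B * phi ^ 3 + x ^ 3 by rewrite /x; ring.
have e : y * x = A * B * phi ^ 3 / 2 by rewrite /x /y; field.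
have : 0 <= A * B * phi ^ 3 by apply: Rmult_le_pos => //; exact: Rmult_le_pos.
have : 0 <= x ^ 3 by exact: pow_le.
lra.
Qed.

(** The characteristic function has two expansions at 0 with cubic error: one
    from the definition of the moments, one from its closeness to the Gaussian
    with parameters A and B.  Comparing imaginary parts gives the mean, comparing
    real parts the second moment. *)
Lemma raw_moments_eq : raw_moment 1 = A /\ raw_moment 2 = A ^ 2 + B.
Proof.
have hA : 0 <= A by exact: Series_part_moment_ge0.
have hB : 0 <= B by exact: Series_part_moment_ge0.
have hK : 0 <= K by exact: Series_part_moment_ge0.
have hE3 : 0 <= raw_moment 3.
  apply: Rle_trans (big_le_Series 0 _ (ex_series_moment 3)); first by rewrite big_ord0; lra.
  by move=> i; apply: Rmult_le_pos; [apply: pow_le; exact: pos_INR | exact: partition_prob_ge0].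
set phi0 := / (24 * K + 1).
have hphi0 : 0 < phi0 <= 1.
  split; first by apply: Rinv_0_lt_compat; lra.
  by rewrite -Rinv_1; apply: Rinv_le_contravar; lra.
have hg phi : 0 < phi <= phi0 ->
  Cmod (partition_cf k u phi - expi (phi * A)%coqR * exp (- (phi ^ 2 / 2 * B))%coqR)%C <= 24 * (phi ^ 3 * K).
  move=> hphi; apply: cf_near_gaussian; first lra.
  have h1 : phi * (24 * K + 1) <= 1.
    apply: (Rle_trans _ (phi0 * (24 * K + 1))); first by apply: Rmult_le_compat_r; lra.
    by apply: Req_le; rewrite /phi0; field; lra.
  have : phi ^ 3 <= phi by have -> : phi ^ 3 = phi * (phi * phi) by [ring]; nra.
  nra.
have eR phi : Re (expi (phi * A)%coqR * exp (- (phi ^ 2 / 2 * B))%coqR)%C = exp (- (phi ^ 2 / 2 * B)) * cos (phi * A).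
  by rewrite /expi /RtoC /Cmult /=; ring.
have eI phi : Im (expi (phi * A)%coqR * exp (- (phi ^ 2 / 2 * B))%coqR)%C = exp (- (phi ^ 2 / 2 * B)) * sin (phi * A).
  by rewrite /expi /RtoC /Cmult /=; ring.
split.
  apply: Rminus_diag_uniq.
  apply: (@eq0_of_cubic_bound _ (raw_moment 3 + 24 * K + (A * B + A ^ 3)) phi0); first lra.
    have : 0 <= A * B + A ^ 3 by apply: Rplus_le_le_0_compat; [exact: Rmult_le_pos | exact: pow_le].
    lra.
  move=> phi hphi.
  have h1 := cf_im_taylor phi; rewrite (Rabs_pos_eq phi) in h1; last lra.
  have h2 := Rle_trans _ _ _ (im_le_Cmod _) (hg phi hphi).
  rewrite (_ : forall a b : C, Im (a - b)%C = Im a - Im b) // eI in h2.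
  have [_ h3] : _ := @gaussian_taylor phi ltac:(lra).
  have h4 : Rabs (phi * (raw_moment 1 - A)) <= (raw_moment 3 + 24 * K + (A * B + A ^ 3)) * phi ^ 3.
    move: h1 h2 h3; set Z := Im _; set G := exp _ * sin _; move=> h1 h2 h3.
    have -> : phi * (raw_moment 1 - A) = - (Z - phi * raw_moment 1) + ((Z - G) + (G - phi * A)) by ring.
    apply: Rle_trans (Rabs_triang _ _) _; rewrite Rabs_Ropp.
    apply: Rle_trans (Rplus_le_compat_l _ _ _ (Rabs_triang _ _)) _.
    lra.
  have -> : (raw_moment 1 - A) * phi ^ 2 = phi * (phi * (raw_moment 1 - A)) by ring.
  rewrite Rabs_mult Rabs_pos_eq; last lra.
  have := Rabs_pos (phi * (raw_moment 1 - A)); nra.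
apply: Rminus_diag_uniq.
set c := B ^ 2 + (1 + B) * A ^ 3 + B * A ^ 2.
have hc : 0 <= c.
  rewrite /c; have := pow_le _ 3 hA; have := pow_le _ 2 hA; have := pow_le _ 2 hB => h1 h2 h3.
  have := Rmult_le_pos _ _ hB h2; have := Rmult_le_pos _ _ hB h3; lra.
apply: (@eq0_of_cubic_bound _ (2 * (raw_moment 3 + 24 * K + c)) phi0); [lra | lra |].
move=> phi hphi.
have h1 := cf_re_taylor phi; rewrite (Rabs_pos_eq phi) in h1; last lra.
have h2 := Rle_trans _ _ _ (re_le_Cmod _) (hg phi hphi).
rewrite (_ : forall a b : C, Re (a - b)%C = Re a - Re b) // eR in h2.
have [h3 _] : _ := @gaussian_taylor phi ltac:(lra).
rewrite -/c in h3.
move: h1 h2 h3; set Z := Re _; set G := exp _ * cos _; move=> h1 h2 h3.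
have -> : (raw_moment 2 - (A ^ 2 + B)) * phi ^ 2 =
  2 * ((Z - (1 - phi ^ 2 / 2 * raw_moment 2)) + (- (Z - G) + - (G - (1 - phi ^ 2 / 2 * (B + A ^ 2))))) by field.
rewrite Rabs_mult (Rabs_pos_eq 2); last lra.
rewrite Rmult_assoc; apply: Rmult_le_compat_l; first lra.
apply: Rle_trans (Rabs_triang _ _) _.
apply: Rle_trans (Rplus_le_compat_l _ _ _ (Rabs_triang _ _)) _.
rewrite !Rabs_Ropp; lra.
Qed.

Lemma khinchin_mean_partition :
  khinchin_mean (power_partition_series k) t = A.
Proof.
rewrite -(proj1 raw_moments_eq); apply: Series_ext => n.
by rewrite pow_1.
Qed.

Lemma khinchin_var_partition :
  khinchin_var (power_partition_series k) t = B.
Proof.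
have [h1 h2] := raw_moments_eq.
rewrite /khinchin_var /khinchin_E khinchin_mean_partition.
have -> : B = raw_moment 2 - (2 * A * raw_moment 1 - A ^ 2 * raw_moment 0) by rewrite raw_moment0 h1 h2; ring.
have h3 : ex_series (fun n => 2 * A * (INR n ^ 1 * p n)).
  by apply: (ex_series_scal (2 * A)); exact: ex_series_moment.
have h4 : ex_series (fun n => A ^ 2 * (INR n ^ 0 * p n)).
  by apply: (ex_series_scal (A ^ 2)); exact: ex_series_moment.
have h5 : ex_series (fun n => 2 * A * (INR n ^ 1 * p n) - A ^ 2 * (INR n ^ 0 * p n)).
  exact: (ex_series_minus (V := R_NormedModule) _ _ h3 h4).
have h6 := ex_series_moment 2.
rewrite /raw_moment -(Series_scal_l (2 * A)) -(Series_scal_l (A ^ 2)) -!Series_minus //.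
apply: Series_ext => n; rewrite /p /partition_prob -/t. ring.
Qed.

Lemma khinchin_charfun_partition theta (sigma := khinchin_sigma (power_partition_series k) t) :
  sigma <> 0 ->
  khinchin_charfun (power_partition_series k) t theta =
  (partition_cf k u (theta / sigma) * expi (- (theta / sigma * A))%coqR)%C.
Proof.
move=> hs; set phi := theta / sigma.
have e n : theta * khinchin_normalized (power_partition_series k) t n = INR n * phi + - (phi * A).
  by rewrite /khinchin_normalized khinchin_mean_partition -/sigma /phi; field.
have ec : ex_series (fun n => cos (INR n * phi) * p n).
  by apply: ex_series_trig => n; exact: Rabs_cos_le1.
have es : ex_series (fun n => sin (INR n * phi) * p n).
  by apply: ex_series_trig => n; exact: Rabs_sin_le1.
rewrite partition_cf_coords /khinchin_charfun /khinchin_EC /khinchin_E {1}/expi /Cmult /=; congr pair.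
  rewrite -!Series_scal_r -Series_minus; try exact: (ex_series_scal_r _ (fun n => _ * p n)).
  apply: Series_ext => n; rewrite e cos_plus /p /partition_prob -/t; ring.
rewrite -!Series_scal_r -Series_plus; try exact: (ex_series_scal_r _ (fun n => _ * p n)).
apply: Series_ext => n; rewrite e sin_plus /p /partition_prob -/t; ring.
Qed.
End Moments.

(** * Equidistribution of n^k y by finite differences *)

Fixpoint forward_diff (d j : nat) (g : nat -> R) (a : nat) : R :=
  if j is j'.+1 then forward_diff d j' g (a + d)%N - forward_diff d j' g a else g a.

Lemma Rabs_sin_minus x y : Rabs (sin (x - y)) <= Rabs (sin x) + Rabs (sin y).
Proof.
rewrite sin_minus /Rminus; apply: Rle_trans (Rabs_triang _ _) _.
rewrite Rabs_Ropp !Rabs_mult.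
have := Rabs_pos (sin x); have := Rabs_pos (sin y).
have := Rabs_cos_le1 x; have := Rabs_cos_le1 y; nra.
Qed.

(** Being subadditive, |sin| plays the role of the distance to the nearest
    multiple of pi. *)
Lemma Rabs_sin_forward_diff d j g a e : (forall i, (i <= j)%N -> Rabs (sin (g (a + i * d)%N)) <= e) ->
  Rabs (sin (forward_diff d j g a)) <= 2 ^ j * e.
Proof.
elim: j a => [|j IH] a h.
  by have := h 0%N isT; rewrite mul0n addn0 /= Rmult_1_l.
rewrite [forward_diff _ _ _ _]/=; apply: Rle_trans (Rabs_sin_minus _ _) _.
have h1 : Rabs (sin (forward_diff d j g (a + d))) <= 2 ^ j * e.
  by apply: IH => i hi; rewrite -addnA -mulSn; exact: h.
have h2 : Rabs (sin (forward_diff d j g a)) <= 2 ^ j * e.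
  by apply: IH => i hi; apply: h; exact: leqW.
rewrite [2 ^ j.+1]/=; lra.
Qed.

(** Leibniz rule for the product with the identity; it drives the induction for
    powers. *)
Lemma forward_diff_mulX d j g a :
  forward_diff d j.+1 (fun x => INR x * g x) a =
  INR a * forward_diff d j.+1 g a + INR j.+1 * INR d * forward_diff d j g (a + d)%N.
Proof.
elim: j a => [|j IH] a.
  by rewrite /= plus_INR; ring.
rewrite [LHS]/= -/(forward_diff d j.+1 (fun x => INR x * g x) (a + d)) -/(forward_diff d j.+1 (fun x => INR x * g x) a).
rewrite !IH (S_INR j.+1).
have -> : forward_diff d j.+2 g a = forward_diff d j.+1 g (a + d)%N - forward_diff d j.+1 g a by [].
have -> : forward_diff d j.+1 g (a + d)%N = forward_diff d j g (a + d + d)%N - forward_diff d j g (a + d)%N by [].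
rewrite plus_INR; ring.
Qed.

Lemma forward_diff_const d j c a : forward_diff d j.+1 (fun=> c) a = 0.
Proof.
elim: j a => [|j IH] a; first by rewrite /=; ring.
rewrite [LHS]/= -/(forward_diff d j.+1 (fun=> c) (a + d)) -/(forward_diff d j.+1 (fun=> c) a).
by rewrite !IH; ring.
Qed.

Lemma forward_diff_scal d j c g a : forward_diff d j (fun x => c * g x) a = c * forward_diff d j g a.
Proof. elim: j a => [|j IH] a //=; rewrite !IH; ring. Qed.

Lemma forward_diff_pow d j m a :
  ((m < j)%N -> forward_diff d j (fun x => INR x ^ m) a = 0) /\
  (m = j -> forward_diff d j (fun x => INR x ^ m) a = INR j`! * INR d ^ j).
Proof.
elim: j m a => [|j IHj] m a.
  by split => // ->; rewrite /=; ring.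
elim: m a => [|m IHm] a; first by split => // _; exact: forward_diff_const.
split=> [hm|[e]].
  rewrite (forward_diff_mulX d j (fun x => INR x ^ m)) (proj1 (IHm a)); last exact: ltnW.
  by rewrite (proj1 (IHj m (a + d)%N)) //; ring.
rewrite (forward_diff_mulX d j (fun x => INR x ^ m)) (proj1 (IHm a)); last by rewrite e.
rewrite (proj2 (IHj m (a + d)%N)) // factS -multE mult_INR [INR d ^ j.+1]/=; ring.
Qed.

Lemma sum_shift_le (f : nat -> R) c L N : (forall i, 0 <= f i) -> (L + c <= N)%N ->
  \big[Rplus/0]_(a < L) f (a + c)%N <= \big[Rplus/0]_(i < N) f i.
Proof.
move=> hf hN; rewrite -(big_mkord predT (fun a => f (a + c)%N)) -(big_mkord predT f).
have -> : \big[Rplus/0]_(0 <= a < L) f (a + c)%N = \big[Rplus/0]_(c <= i < L + c) f i.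
  by rewrite -{2}[c]add0n big_addn addnK.
rewrite (@big_cat_nat _ _ _ c 0 N) ?(leq_trans (leq_addl L c)) //=.
rewrite (@big_cat_nat _ _ _ (L + c) c N) ?leq_addl //=.
have h1 : 0 <= \big[Rplus/0]_(0 <= i < c) f i by apply: Rsum_ge0.
have h2 : 0 <= \big[Rplus/0]_(L + c <= i < N) f i by apply: Rsum_ge0.
by rewrite -[X in X <= _]Rplus_0_l; apply: Rplus_le_compat => //;
   rewrite -[X in X <= _]Rplus_0_r; apply: Rplus_le_compat_l.
Qed.

Lemma sum_progression_le (f : nat -> R) q J : (forall i, 0 <= f i) -> (0 < q)%N ->
  \big[Rplus/0]_(j < J) f (q * j)%N <= \big[Rplus/0]_(i < q * J) f i.
Proof.
move=> hf hq; elim: J => [|J IH]; first by rewrite muln0 !big_ord0; lra.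
rewrite big_ord_recr -(big_mkord predT f) (@big_cat_nat _ _ _ (q * J)) ?leq_mul //=.
apply: Rplus_le_compat; first by rewrite big_mkord.
rewrite big_ltn; last by rewrite mulnS -[X in (X < _)%N]add0n ltn_add2r.
rewrite -[X in X <= _]Rplus_0_r; apply: Rplus_le_compat_l; exact: Rsum_ge0.
Qed.

Lemma Rsum_const c n : \big[Rplus/0]_(i < n) c = INR n * c.
Proof.
elim: n => [|n IH]; first by rewrite big_ord0 /=; ring.
by rewrite big_ord_recr IH S_INR /=; ring.
Qed.

Lemma Rsum_term_le (f : nat -> R) n i : (forall i, 0 <= f i) -> (i < n)%N ->
  f i <= \big[Rplus/0]_(j < n) f j.
Proof.
move=> hf hi; rewrite (bigD1 (Ordinal hi)) //= -[X in X <= _]Rplus_0_r.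
by apply: Rplus_le_compat_l; exact: Rsum_ge0.
Qed.

(** If all k + 1 sines in the window were small, so would be the sine of their
    k-th difference k! d^k y, which does not depend on the position a. *)
Lemma window_bound k d y a :
  (Rabs (sin (INR k`! * INR d ^ k * y)) / 2 ^ k) ^ 2 <=
  \big[Rplus/0]_(i < k.+1) sin (INR (a + i * d) ^ k * y) ^ 2.
Proof.
set S := \big[Rplus/0]_(i < k.+1) _.
have hS : 0 <= S by apply: Rsum_ge0 => i _; exact: pow2_ge_0.
have h : Rabs (sin (INR k`! * INR d ^ k * y)) <= 2 ^ k * sqrt S.
  have -> : INR k`! * INR d ^ k * y = forward_diff d k (fun x => y * INR x ^ k) a.
    by rewrite forward_diff_scal (proj2 (forward_diff_pow d k k a)) //; ring.
  apply: Rabs_sin_forward_diff => i hi; rewrite -sqrt_Rsqr_abs; apply: sqrt_le_1_alt.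
  rewrite Rsqr_pow2 Rmult_comm.
  apply: (@Rsum_term_le (fun i => sin (INR (a + i * d) ^ k * y) ^ 2)) => // j; exact: pow2_ge_0.
have h2 : 0 < 2 ^ k by apply: pow_lt; lra.
have h3 : Rabs (sin (INR k`! * INR d ^ k * y)) / 2 ^ k <= sqrt S.
  apply: (Rmult_le_reg_r (2 ^ k)) => //.
  by have -> : Rabs (sin (INR k`! * INR d ^ k * y)) / 2 ^ k * 2 ^ k = Rabs (sin (INR k`! * INR d ^ k * y)) by [field; lra]; lra.
rewrite -[S]sqrt_sqrt //.
have h0 : 0 <= Rabs (sin (INR k`! * INR d ^ k * y)) / 2 ^ k by apply: Rdiv_le_0_compat => //; exact: Rabs_pos.
have := sqrt_pos S; nra.
Qed.

(** Summing [window_bound] over L consecutive positions counts each index at most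
    k + 1 times. *)
Lemma windows_sum k d y L N : (L + k * d <= N)%N ->
  INR L * (Rabs (sin (INR k`! * INR d ^ k * y)) / 2 ^ k) ^ 2 <=
  INR k.+1 * \big[Rplus/0]_(i < N) sin (INR i.+1 ^ k * y) ^ 2.
Proof.
move=> hN; rewrite -(Rsum_const _ L) -(Rsum_const _ k.+1).
apply: (Rle_trans _ (\big[Rplus/0]_(a < L) \big[Rplus/0]_(i < k.+1) sin (INR (a.+1 + i * d) ^ k * y) ^ 2)).
  by apply: Rsum_le => a _; exact: window_bound.
rewrite exchange_big /=; apply: Rsum_le => i _.
apply: (@sum_shift_le (fun m => sin (INR m.+1 ^ k * y) ^ 2)) => [m|]; first exact: pow2_ge_0.
by apply: leq_trans hN; rewrite leq_add2l leq_mul2r -ltnS ltn_ord orbT.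
Qed.

Lemma sin_ge_third x : 0 <= x <= PI / 2 -> x / 3 <= sin x.
Proof.
move=> hx; have h := sin_taylor_nonneg (proj1 hx); have := PI_4 => h4.
have : x ^ 2 <= 4 by nra.
have : x ^ 3 = x * x ^ 2 by ring.
nra.
Qed.

Lemma PI_half_bounds : 3 / 2 < PI / 2 <= 2.
Proof. have := PI2_3_2; have := PI_4; rewrite /PI2; lra. Qed.

Lemma Rabs_sin_shift n x : Rabs (sin (INR n * PI + x)) = Rabs (sin x).
Proof.
elim: n => [|n IH]; first by rewrite /= Rmult_0_l Rplus_0_l.
have -> : INR n.+1 * PI + x = (INR n * PI + x) + PI by rewrite S_INR; ring.
by rewrite neg_sin Rabs_Ropp.
Qed.

Lemma Rabs_sin_le x : Rabs (sin x) <= Rabs x.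
Proof.
wlog hx : x / 0 <= x => [h|].
  case: (Rle_lt_dec 0 x) => hx; first exact: h.
  by have := h (- x); rewrite sin_neg !Rabs_Ropp; apply; lra.
rewrite (Rabs_pos_eq x) //.
case: (Rle_lt_dec x 1) => h; last by have := Rabs_sin_le1 x; lra.
have h1 := sin_le_self hx; have h2 := @sin_ge_third x; have := PI_half_bounds => h3.
by apply: Rabs_le; lra.
Qed.

Lemma nearest_multiple_PI x : 0 <= x ->
  exists (p : nat) (b : R), x = INR p * PI + b /\ Rabs b <= PI / 2.
Proof.
move=> hx; have hpi := PI_half_bounds.
have [p hp] := nfloor_ex (x / PI + / 2) ltac:(by have := Rdiv_le_0_compat x PI hx; lra).
exists p, (x - INR p * PI); split; first ring.
have e : x = x / PI * PI by field; lra.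
rewrite {1}e; apply: Rabs_le; nra.
Qed.

(** From d + 1 to d the quantity d^k b shrinks at most by the factor 2^k, so in
    descending from M it cannot jump over the target interval. *)
Lemma least_scale (k M : nat) (b : R) : 0 <= b <= PI / 2 -> (0 < M)%N ->
  / (2 ^ k * 4) <= INR M ^ k * b ->
  exists d : nat, (0 < d <= M)%N /\ / (2 ^ k * 4) <= INR d ^ k * b <= PI / 2.
Proof.
move=> hb hM h; have hpi := PI_half_bounds.
have h2k : 0 < 2 ^ k by apply: pow_lt; lra.
elim: M hM h => // M IH _ h.
case: (Rle_lt_dec (INR M.+1 ^ k * b) (PI / 2)) => h1.
  by exists M.+1; split; [rewrite leqnn | lra].
case: M IH h h1 => [|M] IH h h1; first by rewrite pow1 in h1; lra.
suff : / (2 ^ k * 4) <= INR M.+1 ^ k * b.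
  by move=> h2; have [d [/andP[hd hdM] hd2]] := IH isT h2; exists d; rewrite hd (leqW hdM).
have h3 : INR M.+2 ^ k <= (2 * INR M.+1) ^ k.
  apply: pow_incr; rewrite (S_INR M.+1) (S_INR M); have := pos_INR M; lra.
rewrite Rpow_mult_distr in h3.
have h4 : 1 / 4 <= 2 ^ k * (INR M.+1 ^ k * b).
  by apply: (Rle_trans _ (INR M.+2 ^ k * b)); [lra | rewrite -Rmult_assoc; apply: Rmult_le_compat_r; lra].
apply: (Rmult_le_reg_l (2 ^ k)) => //; apply: Rle_trans h4.
by apply: Req_le; field; lra.
Qed.

Lemma expn_progression q j k : exists L, ((q * j).+1 ^ k = 1 + q * L)%N.
Proof.
elim: k => [|k [L IH]]; first by exists 0%N; rewrite expn0 muln0.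
by exists (j * (1 + q * L) + L)%N; rewrite expnS IH mulSn -addnA [in RHS]mulnDr mulnA [X in (_ + X)%N = _]addnC.
Qed.

(** Reduce k! y modulo pi to b.  If M^k |b| > 1/4 with M = k! J, some step d <= M
    makes |sin(k! d^k y)| = |sin(d^k b)| bounded below, and the windows of step d
    starting below k M stay below 2 k M.  Otherwise b is negligible for all
    n <= M.  Then either k! y = b, which is the first alternative, or y is at
    least of order 1 / k! and n^k y is close to y modulo pi for every n = 1
    mod k!. *)
Lemma sin_power_sum_dichotomy k : (0 < k)%N ->
  exists c : R, 0 < c /\ forall (y : R) (J : nat), 0 < y <= PI / 2 -> (0 < J)%N ->
    INR (k`! * J) ^ k * y <= 1 / 4 \/
    c * INR J <= \big[Rplus/0]_(i < 2 * k * (k`! * J)) sin (INR i.+1 ^ k * y) ^ 2.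
Proof.
move=> hk; set q := k`!.
have hq : (0 < q)%N by exact: fact_gt0.
have hqR : 1 <= INR q by have := leR_nat hq; rewrite /=.
have hpi := PI_half_bounds.
have h2k : 0 < 2 ^ k by apply: pow_lt; lra.
(* c1 is the gain of one window, c2 that of one n = 1 mod k!. *)
set c1 := (/ (2 ^ k * 4) / 3 / 2 ^ k) ^ 2.
have hc1 : 0 < c1.
  apply: pow_lt; apply: Rdiv_lt_0_compat => //; apply: Rdiv_lt_0_compat; last lra.
  by apply: Rinv_0_lt_compat; lra.
set c2 := (/ (4 * INR q)) ^ 2.
have hc2 : 0 < c2 by apply: pow_lt; apply: Rinv_0_lt_compat; lra.
exists (Rmin (c1 / 2) c2); split; first by apply: Rmin_pos; lra.
move=> y J hy hJ; set M := (q * J)%N; set N := (2 * k * M)%N.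
have hM : (0 < M)%N by rewrite muln_gt0 hq.
have hMN : (M <= N)%N by rewrite /N -mulnA mulnCA mulnA leq_pmull // muln_gt0 hk.
have hJM : INR J <= INR M by apply: leR_nat; exact: leq_pmull.
have hJ0 : 0 <= INR J := pos_INR J.
have [p [b [e hb]]] := @nearest_multiple_PI (INR q * y) ltac:(nra).
case: (Rle_lt_dec (INR M ^ k * Rabs b) (1 / 4)) => hMb; last first.
  right.
  have hb' : 0 <= Rabs b <= PI / 2 by split => //; exact: Rabs_pos.
  have [|d [/andP[hd0 hdM] hd]] := least_scale hb' hM (k := k).
    apply: Rle_trans (_ : / 4 <= _); last lra.
    by apply: Rinv_le_contravar; [lra | have := pow_R1_Rle 2 k; lra].
  have hs : / (2 ^ k * 4) / 3 <= Rabs (sin (INR q * INR d ^ k * y)).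
    have -> : INR q * INR d ^ k * y = INR (d ^ k * p)%N * PI + INR d ^ k * b.
      have -> : INR q * INR d ^ k * y = INR d ^ k * (INR q * y) by ring.
      by rewrite e -multE mult_INR INR_expn; ring.
    rewrite Rabs_sin_shift.
    have h := @sin_ge_third (INR d ^ k * Rabs b).
    have -> : Rabs (sin (INR d ^ k * b)) = Rabs (sin (INR d ^ k * Rabs b)).
      case: (Rle_lt_dec 0 b) => hb0; first by rewrite (Rabs_pos_eq b).
      by rewrite (Rabs_left b) // Ropp_mult_distr_r_reverse sin_neg Rabs_Ropp.
    rewrite Rabs_pos_eq; last by have : 0 < / (2 ^ k * 4) by [apply: Rinv_0_lt_compat; lra]; lra.
    have : 0 < / (2 ^ k * 4) by apply: Rinv_0_lt_compat; lra.
    lra.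
  have hw : (k * M + k * d <= N)%N.
    by rewrite /N -mulnA mul2n -addnn leq_add2l leq_mul2l hdM orbT.
  have := windows_sum y hw; rewrite -/q => h.
  set S := \big[Rplus/0]_(i < N) _ in h *.
  have hc : c1 <= (Rabs (sin (INR q * INR d ^ k * y)) / 2 ^ k) ^ 2.
    apply: pow_incr; split.
      apply: Rdiv_le_0_compat => //; apply: Rdiv_le_0_compat; last lra.
      by left; apply: Rinv_0_lt_compat; lra.
    by apply: Rmult_le_compat_r => //; left; exact: Rinv_0_lt_compat.
  have hk1 : 1 <= INR k by have := leR_nat hk; rewrite /=.
  rewrite -multE mult_INR S_INR in h.
  have h1 : INR k * INR M * c1 <= (INR k + 1) * S.
    apply: Rle_trans h; apply: Rmult_le_compat_l => //; nra.
  have h2 : (INR k + 1) * (c1 / 2 * INR J) <= (INR k + 1) * S.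
    apply: Rle_trans h1.
    have hP : 0 <= (INR k - 1) * (c1 * INR J) by apply: Rmult_le_pos; [lra | apply: Rmult_le_pos; lra].
    have hQ : 0 <= INR k * (c1 * (INR M - INR J)) by apply: Rmult_le_pos; [lra | apply: Rmult_le_pos; lra].
    lra.
  apply: Rle_trans (_ : c1 / 2 * INR J <= S); last by apply: Rmult_le_reg_l h2; lra.
  by apply: Rmult_le_compat_r => //; exact: Rmin_l.
case: p e => [|p] e.
  left; rewrite /= Rmult_0_l Rplus_0_l in e.
  rewrite -e Rabs_pos_eq in hMb; last nra.
  have h0 : 0 <= INR M ^ k * y by apply: Rmult_le_pos; [apply: pow_le; exact: pos_INR | lra].
  rewrite -/q -/M; nra.
right.
have hy1 : / (2 * INR q) <= Rabs (sin y).
  have hyq : PI / 2 <= INR q * y.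
    move: e; rewrite S_INR => ->; have := pos_INR p; have := Rle_abs (- b); rewrite Rabs_Ropp; nra.
  have h3 : / (2 * INR q) <= y / 3.
    apply: (Rmult_le_reg_l (2 * INR q)); first lra.
    by rewrite Rinv_r; lra.
  have h4 := @sin_ge_third y ltac:(lra).
  have h5 : 0 < / (2 * INR q) by apply: Rinv_0_lt_compat; lra.
  rewrite Rabs_pos_eq; lra.
have hterm j : (j < J)%N -> / (4 * INR q) <= Rabs (sin (INR (q * j).+1 ^ k * y)).
  move=> hj; have [L hL] := expn_progression q j k.
  have eL : INR (q * j).+1 ^ k = 1 + INR q * INR L.
    by rewrite -INR_expn hL plus_INR -multE mult_INR.
  have h1 : Rabs (sin (INR q * INR L * y)) <= / (4 * INR q).
    have -> : INR q * INR L * y = INR (L * p.+1)%N * PI + INR L * b.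
      have -> : INR q * INR L * y = INR L * (INR q * y) by ring.
      by rewrite e -multE mult_INR; ring.
    rewrite Rabs_sin_shift; apply: Rle_trans (Rabs_sin_le _) _.
    rewrite Rabs_mult (Rabs_pos_eq (INR L)); last exact: pos_INR.
    have hle : INR (q * j).+1 ^ k <= INR M ^ k.
      apply: pow_incr; split; first exact: pos_INR.
      apply: leR_nat; rewrite /M; apply: leq_trans (_ : q * j.+1 <= _)%N.
        by rewrite mulnS -add1n leq_add2r.
      by rewrite leq_mul2l hj orbT.
    have hqL : INR q * (INR L * Rabs b) <= 1 / 4.
      apply: Rle_trans hMb; have := Rabs_pos b; nra.
    apply: (Rmult_le_reg_l (INR q)); first lra.
    by apply: Rle_trans hqL _; apply: Req_le; field; lra.
  have h2 : Rabs (sin y) <= Rabs (sin (INR (q * j).+1 ^ k * y)) + Rabs (sin (INR q * INR L * y)).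
    have {1}-> : y = INR (q * j).+1 ^ k * y - INR q * INR L * y by rewrite eL; ring.
    exact: Rabs_sin_minus.
  have e4 : / (2 * INR q) = / (4 * INR q) + / (4 * INR q) by field; lra.
  lra.
apply: (Rle_trans _ (\big[Rplus/0]_(i < M) sin (INR i.+1 ^ k * y) ^ 2)); last first.
  have := @sum_shift_le (fun m => sin (INR m.+1 ^ k * y) ^ 2) 0 M N.
  rewrite addn0 => h; apply: Rle_trans (h _ hMN); last by move=> i; exact: pow2_ge_0.
  by apply: Req_le; apply: eq_bigr => i _; rewrite addn0.
apply: Rle_trans (@sum_progression_le (fun m => sin (INR m.+1 ^ k * y) ^ 2) q J _ hq); last first.
  by move=> i; exact: pow2_ge_0.
rewrite Rmult_comm -(Rsum_const _ J); apply: Rsum_le => j _.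
apply: Rle_trans (Rmin_r _ _) _; rewrite -(Rsqr_pow2 (sin _)) Rsqr_abs Rsqr_pow2.
apply: pow_incr; split; first by left; apply: Rinv_0_lt_compat; lra.
exact: hterm.
Qed.

(** * Decay on the minor arc *)

Lemma Cmod_geometric_factor q x : 0 < q < 1 ->
  Cmod ((1 - q) / (1 - q * expi x))%C ^ 2 =
    / (1 + 4 * q * sin (x / 2) ^ 2 / (1 - q) ^ 2).
Proof.
move=> hq.
have h : (1 - q * expi x)%C <> 0.
  by apply: one_sub_neq0; rewrite Cmod_mult Cmod_expi Cmod_R Rabs_pos_eq; lra.
have e : Cmod (1 - q * expi x)%C ^ 2 = (1 - q) ^ 2 + 4 * q * sin (x / 2) ^ 2.
  rewrite Cmod2_alt /=.
  have hc : cos x = 1 - 2 * sin (x / 2) * sin (x / 2).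
    by rewrite -cos_2a_sin; congr cos; field.
  have hs := sin2_cos2 x; rewrite /Rsqr in hs.
  have -> : sin (x / 2) * (sin (x / 2) * 1) = (1 - cos x) / 2 by rewrite hc; field.
  have : sin x * sin x = 1 - cos x * cos x by lra.
  move=> hss.
  have -> : forall s, (1 + - (q * cos x - 0 * s)) * ((1 + - (q * cos x - 0 * s)) * 1) +
     (0 + - (q * s + 0 * cos x)) * ((0 + - (q * s + 0 * cos x)) * 1)
     = 1 - 2 * q * cos x + q * q * (cos x * cos x) + q * q * (s * s) by move=> s; ring.
  rewrite hss; field.
have hp : 0 <= 4 * q * sin (x / 2) ^ 2.
  by apply: Rmult_le_pos; [lra | exact: pow2_ge_0].
have h2 : 0 < (1 - q) ^ 2 by apply: pow_lt; lra.
rewrite Cmod_div // -RtoC_minus Cmod_R Rabs_pos_eq; last lra.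
have -> : ((1 - q) / Cmod (1 - q * expi x)%C) ^ 2 = (1 - q) ^ 2 * / Cmod (1 - q * expi x)%C ^ 2.
  by rewrite /Rdiv Rpow_mult_distr pow_inv.
rewrite e; field; lra.
Qed.

(** All factors have modulus at most 1, so those beyond N may be dropped; the
    others satisfy |factor|^2 <= 1 / (1 + Y) <= exp(-Y / 2) for 0 <= Y <= 1. *)
Lemma Cmod_cf_le k u phi (Y : nat -> R) N : (0 < k)%N -> 0 < u ->
  (forall i, (i < N)%N -> 0 <= Y i <= 1) ->
  (forall i, (i < N)%N -> Y i <= 4 * part_prob k u i * sin (part_weight k i * phi / 2) ^ 2 / (1 - part_prob k u i) ^ 2) ->
  Cmod (partition_cf k u phi) <= exp (- / 4 * \big[Rplus/0]_(i < N) Y i).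
Proof.
move=> hk hu hY hYX.
have -> : partition_cf k u phi = (partition_cf k u phi - 0)%C by ring.
apply: (is_Clim_seq_Cmod_le (cf_partial_lim phi hk hu)).
exists N => N' /leP hN.
rewrite /Cminus Copp_0 Cplus_0_r /cf_partial Cmod_prod.
set F := fun i => Cmod ((1 - part_prob k u i) / (1 - part_prob k u i * expi (part_weight k i * phi)%coqR))%C.
have hF i : 0 <= F i <= 1 /\ forall y, 0 <= y <= 1 ->
  y <= 4 * part_prob k u i * sin (part_weight k i * phi / 2) ^ 2 / (1 - part_prob k u i) ^ 2 ->
  F i <= exp (- / 4 * y).
  have hq := part_prob_lt1 k i hu.
  have e : F i ^ 2 = _ := Cmod_geometric_factor (part_weight k i * phi) hq.
  set X := 4 * _ * _ / _ in e *.
  have hX : 0 <= X.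
    apply: Rdiv_le_0_compat; last by apply: pow_lt; lra.
    by apply: Rmult_le_pos; [lra | exact: pow2_ge_0].
  have hF0 : 0 <= F i by exact: Cmod_ge_0.
  have h1 : F i ^ 2 * (1 + X) = 1 by rewrite e Rinv_l //; lra.
  split.
    split => //; have := pow2_ge_0 (F i); nra.
  move=> y hy hyX.
  have hp := exp_pos (- / 4 * y).
  apply: (Rsqr_incr_0 _ _ _ hF0 (Rlt_le _ _ hp)).
  rewrite !Rsqr_pow2 exp_pow.
  have -> : INR 2 * (- / 4 * y) = - (y / 2) by rewrite /=; field.
  rewrite exp_Ropp e; apply: Rinv_le_contravar; first exact: exp_pos.
  apply: Rle_trans (_ : 1 + y <= _); last lra.
  have h3 := exp_ineq1_le (- (y / 2)); rewrite exp_Ropp in h3.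
  have h4 := exp_pos (y / 2).
  have h5 : exp (y / 2) * / exp (y / 2) = 1 by rewrite Rinv_r //; lra.
  have : exp (y / 2) * (1 - y / 2) <= 1 by nra.
  nra.
rewrite -(big_mkord predT F) (@big_cat_nat _ _ _ N) //= Rsum_distrr exp_sum big_mkord.
rewrite -[X in _ <= X]Rmult_1_r.
have hge (r : seq nat) : 0 <= \big[Rmult/1]_(i <- r) F i <= 1.
  apply: (big_ind (fun x => 0 <= x <= 1)) => [|x y hx hy|i _]; [lra | nra | by case: (hF i)].
apply: Rmult_le_compat.
- by rewrite -(big_mkord predT F); case: (hge (index_iota 0 N)).
- by case: (hge (index_iota N N')).
- apply: Rprod_le => i _; case: (hF i) => -[h0 _] h; split => //.
  by apply: h; [exact: hY | exact: hYX].
- by case: (hge (index_iota N N')).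
Qed.

(** For n <= N the hypothesis on J gives s n^k <= 1, hence q_n >= 1/3 and
    1 - q_n <= s n^k.  The two alternatives of [sin_power_sum_dichotomy] then
    bound the sum of the min(1, X_n) below by a constant times eta^2 J,
    respectively by a constant times J. *)
Lemma minor_arc k : (0 < k)%N ->
  exists c : R, 0 < c /\ forall (u eta phi : R) (J : nat), 0 < u -> 0 < eta <= 1 ->
    (0 < J)%N -> INR (2 * k * (k`! * J)) * u <= 1 ->
    u ^ k * eta <= Rabs phi <= PI ->
    Cmod (partition_cf k u phi) <= exp (- (c * (eta ^ 2 * INR J))).
Proof.
move=> hk; have [c [hc hdich]] := sin_power_sum_dichotomy hk.
exists (Rmin (c / 4) (/ 144)); split; first by apply: Rmin_pos; lra.
move=> u eta phi J hu heta hJ hN hphi.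
set N := (2 * k * (k`! * J))%N in hN; set M := (k`! * J)%N.
have hMN : (M <= N)%N by rewrite /N -/M leq_pmull // muln_gt0 hk.
have hJM : (J <= M)%N by rewrite /M leq_pmull // fact_gt0.
have hpi := PI_half_bounds.
set y := Rabs phi / 2.
have hs : 0 < u ^ k by exact: pow_lt.
have hy : 0 < y <= PI / 2.
  rewrite /y; have : 0 < u ^ k * eta by apply: Rmult_lt_0_compat; lra.
  lra.
have hJ0 : 0 < INR J by apply: lt_0_INR; apply/ltP.
have heta2 : 0 < eta ^ 2 <= 1 by split; [apply: pow_lt; lra | nra].
have hsin i : sin (part_weight k i * phi / 2) ^ 2 = sin (INR i.+1 ^ k * y) ^ 2.
  rewrite /y /part_weight /Rabs; case: Rcase_abs => h.
    have -> : INR i.+1 ^ k * (- phi / 2) = - (INR i.+1 ^ k * phi / 2) by field.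
    by rewrite sin_neg -!Rsqr_pow2 -Rsqr_neg.
  by congr (sin _ ^ 2); field.
have hX i x : (i < N)%N -> 0 <= x <= 1 ->
  x * (u ^ k * INR i.+1 ^ k) ^ 2 <= sin (INR i.+1 ^ k * y) ^ 2 ->
  x <= 4 * part_prob k u i * sin (part_weight k i * phi / 2) ^ 2 / (1 - part_prob k u i) ^ 2.
  move=> hi hx hxs; rewrite hsin.
  have hq := part_prob_lt1 k i hu.
  have hi1 : 0 < INR i.+1 by apply: lt_0_INR; lia.
  have hiN : INR i.+1 <= INR N by exact: leR_nat.
  set v := u ^ k * INR i.+1 ^ k in hxs.
  have ev : part_prob k u i = exp (- v) by rewrite /part_prob Rpow_mult_distr.
  have hv : 0 < v <= 1.
    rewrite /v -Rpow_mult_distr; split; first by apply: pow_lt; nra.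
    rewrite -(pow1 k); apply: pow_incr; nra.
  have h1 : 1 - v <= exp (- v) by have := exp_ineq1_le (- v); lra.
  have h2 : / 3 <= exp (- v).
    rewrite exp_Ropp; apply: Rinv_le_contravar; first exact: exp_pos.
    by apply: Rle_trans exp_le_3; apply: exp_le; lra.
  rewrite ev in hq *; set Q := exp (- v) in hq h1 h2 *.
  apply: (Rmult_le_reg_r ((1 - Q) ^ 2)); first by apply: pow_lt; lra.
  have -> : 4 * Q * sin (INR i.+1 ^ k * y) ^ 2 / (1 - Q) ^ 2 * (1 - Q) ^ 2 = 4 * Q * sin (INR i.+1 ^ k * y) ^ 2 by field; lra.
  apply: Rle_trans (_ : x * v ^ 2 <= _).
    by apply: Rmult_le_compat_l; [lra | apply: pow_incr; lra].
  have := pow2_ge_0 (sin (INR i.+1 ^ k * y)); nra.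
have hv1 i : (i < N)%N -> (u ^ k * INR i.+1 ^ k) ^ 2 <= 1.
  move=> hi; have hiN : INR i.+1 <= INR N by exact: leR_nat.
  rewrite -Rpow_mult_distr -(pow1 2); apply: pow_incr.
  have h0 := pos_INR i.+1.
  split; first by apply: pow_le; nra.
  by rewrite -(pow1 k); apply: pow_incr; nra.
case: (hdich y J hy hJ) => h.
  apply: Rle_trans (@Cmod_cf_le k u phi (fun=> eta ^ 2 / 36) M hk hu _ _) _.
  - by move=> i hi; lra.
  - move=> i hi; have hi1 : 0 < INR i.+1 by apply: lt_0_INR; lia.
    apply: hX; [exact: leq_trans hMN | lra |].
    (* 36 = 9 * 4, from sin x >= x / 3 and y >= eta s / 2. *)
    have hwy : 0 <= INR i.+1 ^ k * y <= 1 / 4.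
      split; first by apply: Rmult_le_pos; [apply: pow_le; lra | lra].
      apply: Rle_trans h; apply: Rmult_le_compat_r; first lra.
      apply: pow_incr; split; [lra | exact: leR_nat].
    have h3 := @sin_ge_third (INR i.+1 ^ k * y) ltac:(lra).
    apply: Rle_trans (_ : (INR i.+1 ^ k * y / 3) ^ 2 <= _); last by apply: pow_incr; lra.
    have h4 : eta * u ^ k / 2 <= y by rewrite /y; lra.
    have h5 : 0 < INR i.+1 ^ k by exact: pow_lt.
    have h6 : (eta * u ^ k / 2) ^ 2 <= y ^ 2.
      by apply: pow_incr; split => //; apply: Rdiv_le_0_compat; [apply: Rmult_le_pos; lra | lra].
    have h7 : 0 < (INR i.+1 ^ k) ^ 2 by exact: pow_lt.
    have -> : eta ^ 2 / 36 * (u ^ k * INR i.+1 ^ k) ^ 2 = (INR i.+1 ^ k) ^ 2 * (1 / 9 * (eta * u ^ k / 2) ^ 2) by field.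
    have -> : (INR i.+1 ^ k * y / 3) ^ 2 = (INR i.+1 ^ k) ^ 2 * (y ^ 2 / 9) by field.
    apply: Rmult_le_compat_l; first lra.
    have := pow2_ge_0 y; lra.
  apply: exp_le; rewrite Rsum_const.
  have hJMR : INR J <= INR M by exact: leR_nat.
  have h8 : Rmin (c / 4) (/ 144) <= / 144 by exact: Rmin_r.
  have h9 : 0 < eta ^ 2 * INR J by apply: Rmult_lt_0_compat; lra.
  have h10 : eta ^ 2 * INR J <= eta ^ 2 * INR M by apply: Rmult_le_compat_l; lra.
  nra.
apply: Rle_trans (@Cmod_cf_le k u phi (fun i => sin (INR i.+1 ^ k * y) ^ 2) N hk hu _ _) _.
- move=> i hi; split; first exact: pow2_ge_0.
  by rewrite -(pow1 2) -(Rsqr_pow2 (sin _)) Rsqr_abs Rsqr_pow2; apply: pow_incr; split; [exact: Rabs_pos | exact: Rabs_sin_le1].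
- move=> i hi; apply: hX => //.
    split; first exact: pow2_ge_0.
    by rewrite -(pow1 2) -(Rsqr_pow2 (sin _)) Rsqr_abs Rsqr_pow2; apply: pow_incr; split; [exact: Rabs_pos | exact: Rabs_sin_le1].
  have := hv1 i hi; have := pow2_ge_0 (sin (INR i.+1 ^ k * y)); nra.
apply: exp_le; rewrite -/N in h.
have h8 : Rmin (c / 4) (/ 144) <= c / 4 by exact: Rmin_l.
have h9 : 0 < eta ^ 2 * INR J by apply: Rmult_lt_0_compat; lra.
have h10 : eta ^ 2 * INR J <= INR J by nra.
nra.
Qed.

(** * The Hayman conditions *)

Lemma sup_on_bounds (A : R -> Prop) (g : R -> R) (M : R) :
  0 <= M -> (forall x, A x -> g x <= M) -> 0 <= sup_on A g <= M.
Proof.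
move=> hM h; rewrite /sup_on.
set E := fun y => _.
have [hub hlub] := Lub_Rbar_correct E.
have h1 : Rbar_le (Lub_Rbar E) M.
  by apply: hlub => y [->|[x [hx ->]]] //=; exact: h.
have h0 : Rbar_le 0 (Lub_Rbar E) by apply: hub; left.
by move: h0 h1; case: (Lub_Rbar E) => [r| |] //=.
Qed.

(** The local parameter w near the boundary, with u = w^5 and s = w^(5 k): the
    fifth root makes the cut s w^2 and all error terms integral powers of w. *)
Definition radius_at (k : nat) (w : R) : R := exp (- (w ^ 5) ^ k).
Definition scale_at (k : nat) (t : R) : R := Rpower (- ln t) (/ INR (5 * k)).

Lemma scale_atK k t : (0 < k)%N -> 0 < t < 1 ->
  radius_at k (scale_at k t) = t.
Proof.
move=> hk ht.
have hl : ln t < 0 by rewrite -ln_1; apply: ln_increasing; lra.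
have hn : INR (5 * k) <> 0 by apply: not_0_INR; case: (k) hk.
rewrite /radius_at -pow_mult -[(5 * k)%coq_nat]/(5 * k)%N /scale_at -Rpower_pow; last exact: exp_pos.
rewrite Rpower_mult Rinv_l // Rpower_1; last lra.
by rewrite Ropp_involutive exp_ln //; lra.
Qed.

Lemma radius_atK k w : (0 < k)%N -> 0 < w -> scale_at k (radius_at k w) = w.
Proof.
move=> hk hw; have hn : INR (5 * k) <> 0 by apply: not_0_INR; case: (k) hk.
rewrite /scale_at /radius_at ln_exp Ropp_involutive -pow_mult -[(5 * k)%coq_nat]/(5 * k)%N.
by rewrite -Rpower_pow // Rpower_mult Rinv_r // Rpower_1.
Qed.

Lemma left_nbhs_radius k (P : R -> Prop) w0 : (0 < k)%N -> 0 < w0 ->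
  (forall w, 0 < w < w0 -> P (radius_at k w)) -> left_nbhs 1 P.
Proof.
move=> hk hw0 h.
have hs : 0 < (w0 ^ 5) ^ k by do 2 apply: pow_lt.
have ht0 := exp_lt1 hs.
have hd : 0 < 1 - radius_at k w0 by rewrite /radius_at; lra.
exists (mkposreal _ hd) => t; rewrite /ball /= /AbsRing_ball /abs /minus /plus /opp /= => hb ht.
have ht1 : radius_at k w0 < t by move: hb; rewrite Rabs_left /radius_at; lra.
have htp : 0 < t by apply: Rlt_trans ht1; exact: exp_pos.
rewrite -(scale_atK hk (conj htp ht)); apply: h.
have hw : 0 < scale_at k t by exact: exp_pos.
split=> //; apply: Rnot_le_lt => hle.
have : t <= radius_at k w0; last lra.
rewrite -(scale_atK hk (conj htp ht)); apply: exp_le; apply: Ropp_le_contravar.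
by apply: pow_incr; split; [apply: pow_le; lra | apply: pow_incr; lra].
Qed.

Lemma filterlim_radius0 k (f : R -> R) c w0 : (0 < k)%N -> 0 < w0 -> 0 < c ->
  (forall w, 0 < w < w0 -> 0 <= f (radius_at k w) <= c * w) ->
  filterlim f (left_nbhs 1) (locally 0).
Proof.
move=> hk hw0 hc h; apply/filterlim_locally => eps.
have he := cond_pos eps.
have hec : 0 < eps / c by exact: Rdiv_lt_0_compat.
apply: (@left_nbhs_radius k _ (Rmin w0 (eps / c))) => //; first exact: Rmin_pos.
move=> w [hw hw2].
have hw3 : w < w0 by apply: Rlt_le_trans hw2 (Rmin_l _ _).
have hw4 : c * w < eps.
  have -> : (eps : R) = c * (eps / c) by field; lra.
  by apply: Rmult_lt_compat_l => //; apply: Rlt_le_trans hw2 (Rmin_r _ _).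
have [h1 h2] := h w (conj hw hw3).
rewrite /ball /= /AbsRing_ball /abs /minus /plus /opp /=.
rewrite Rabs_pos_eq; lra.
Qed.

Section FixedScale.
Variables (k : nat) (w : R).
Hypotheses (hk : (0 < k)%N) (hw : 0 < w) (hw1 : w <= 1).
Let a := power_partition_series k.
Let t := radius_at k w.
Let u := w ^ 5.
Let s := u ^ k.
Let sigma := khinchin_sigma a t.

Lemma u_pos : 0 < u. Proof. exact: pow_lt. Qed.
Lemma s_pos : 0 < s. Proof. apply: pow_lt; exact: u_pos. Qed.
Lemma u_le1 : u <= 1. Proof. rewrite /u -(pow1 5); apply: pow_incr; lra. Qed.
Lemma s_le1 : s <= 1.
Proof. rewrite /s -(pow1 k); apply: pow_incr; have := u_pos; have := u_le1; lra. Qed.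

Lemma sigma_sqr : sigma ^ 2 = Series (part_moment k u 2).
Proof.
rewrite /sigma /khinchin_sigma /t /radius_at (khinchin_var_partition hk u_pos).
by rewrite -Rsqr_pow2 Rsqr_sqrt //; apply: Series_part_moment_ge0 => //; exact: u_pos.
Qed.

Lemma sigma_lower : / (2 * w) <= sigma.
Proof.
have hs := s_pos; have hs1 := s_le1; have hu := u_pos.
have hsw : s <= w.
  rewrite /s /u -pow_mult -[X in _ <= X]pow_1; apply: pow_decr; first lra.
  by case: (k) hk.
have h2 : / (4 * s ^ 2) <= sigma ^ 2.
  rewrite sigma_sqr.
  have hpos i : 0 <= part_moment k u 2 i by exact: part_moment_ge0.
  apply: Rle_trans _ (big_le_Series 1 hpos (ex_series_part_moment hk hu (j := 2) isT)).
  rewrite big_ord1 /part_moment /part_weight /part_prob [INR _]/= pow1 Rmult_1_r -/s.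
  have hq := exp_lt1 hs; have h1 := exp_ineq1_le (- s).
  have h3 : / 4 <= exp (- s).
    rewrite exp_Ropp; apply: Rinv_le_contravar; first exact: exp_pos.
    by have := exp_le_3; have := exp_le hs1; lra.
  rewrite Rinv_mult; apply: Rmult_le_compat => //; try lra.
    by left; apply: Rinv_0_lt_compat; apply: pow_lt.
  rewrite -pow_inv; apply: pow_incr; split; first by left; exact: Rinv_0_lt_compat.
  by rewrite /Rdiv Rmult_1_l; apply: Rinv_le_contravar; lra.
have h4 : / (2 * w) <= / (2 * s) by apply: Rinv_le_contravar; lra.
apply: Rle_trans h4 _; apply: Rsqr_incr_0_var; last exact: sqrt_pos.
rewrite !Rsqr_pow2; apply: Rle_trans h2; apply: Req_le; field; lra.
Qed.

Lemma sigma_pos : 0 < sigma.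
Proof. by have := sigma_lower; have : 0 < / (2 * w) by [apply: Rinv_0_lt_compat; lra]; lra. Qed.

Lemma sigma_upper : sigma <= 30 / w ^ (5 * k + 5)%N.
Proof.
have hs := s_pos; have hs1 := s_le1; have hu := u_pos; have hu1 := u_le1.
have -> : w ^ (5 * k + 5)%N = s * u by rewrite /s /u pow_add pow_mult.
apply: Rsqr_incr_0_var; last by apply: Rdiv_le_0_compat; [lra | exact: Rmult_lt_0_compat].
rewrite !Rsqr_pow2 sigma_sqr.
apply: Rle_trans (Series_part_moment_le hk hu (j := 2) isT) _.
rewrite -/s.
have -> : (30 / (s * u)) ^ 2 = 900 / (s ^ 2 * u) * / u by field; lra.
have h1 : 1 <= / u by rewrite -Rinv_1; apply: Rinv_le_contravar.
have h2 : 0 < / (s ^ 2 * u) by apply: Rinv_0_lt_compat; apply: Rmult_lt_0_compat => //; exact: pow_lt.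
rewrite /Rdiv; nra.
Qed.

Lemma charfun_radius theta :
  khinchin_charfun a t theta = (partition_cf k u (theta / sigma) *
    expi (- (theta / sigma * Series (part_moment k u 1)))%coqR)%C.
Proof.
apply: (khinchin_charfun_partition hk u_pos).
by have := sigma_pos; rewrite /sigma /t /radius_at -/a -/u; lra.
Qed.

(** For phi = theta / sigma, the bound |phi| <= s w^2 gives
    |phi|^3 K <= s^3 w^6 * 864 / (s^3 w^5) = 864 w. *)
Lemma charfun_major_arc theta : w <= / 20736 -> Rabs theta <= s * w ^ 2 * sigma ->
  Cmod (khinchin_charfun a t theta * RtoC (exp (theta ^ 2 / 2)) - 1)%C <= 20736 * w.
Proof.
move=> hwsm hth; have hsg := sigma_pos; have hs := s_pos; have hu := u_pos.
set phi := theta / sigma.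
have ephi : theta = phi * sigma by rewrite /phi; field; lra.
have hphi : Rabs phi <= s * w ^ 2.
  apply: (Rmult_le_reg_r sigma) => //.
  by rewrite -{1}(Rabs_pos_eq sigma) -?Rabs_mult -?ephi //; lra.
rewrite charfun_radius -/phi.
have -> : theta ^ 2 / 2 = phi ^ 2 / 2 * Series (part_moment k u 2).
  by rewrite -sigma_sqr ephi; field.
rewrite -Cmult_assoc.
have hK : Rabs phi ^ 3 * Series (part_moment k u 3) <= 864 * w.
  apply: (Rle_trans _ ((s * w ^ 2) ^ 3 * (864 / (s ^ 3 * u)))).
    apply: Rmult_le_compat; first by apply: pow_le; exact: Rabs_pos.
    - exact: Series_part_moment_ge0.
    - by apply: pow_incr; split => //; exact: Rabs_pos.
    - exact: Series_part_moment_le.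
  by apply: Req_le; rewrite /u; field; lra.
have hK0 : 0 <= Rabs phi ^ 3 * Series (part_moment k u 3).
  by apply: Rmult_le_pos; [apply: pow_le; exact: Rabs_pos | exact: Series_part_moment_ge0].
have he : exp (6 * (Rabs phi ^ 3 * Series (part_moment k u 3))) - 1 <= 10368 * w.
  by have := @exp_le_double (6 * (Rabs phi ^ 3 * Series (part_moment k u 3))); lra.
have he0 := exp_ineq1_le (6 * (Rabs phi ^ 3 * Series (part_moment k u 3))).
apply: Rle_trans (major_arc (phi := phi) hk hu _) _; first lra.
set e := exp _ - 1 in he *.
have he1 : 0 <= e by rewrite /e; lra.
apply: (Rmult_le_reg_r (1 - e)); first lra.
have -> : e / (1 - e) * (1 - e) = e by field; lra.
nra.
Qed.
End FixedScale.

(** With eta = w^2 and J of order 1 / w^5, [minor_arc] gives exp(-c' / w), which is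
    smaller than any power of w, whereas sigma is at most 30 / w^(5 k + 5). *)
Lemma charfun_minor_arc k : (0 < k)%N -> exists (c w0 : R), 0 < c /\ 0 < w0 <= 1 /\
  forall w theta (sigma := khinchin_sigma (power_partition_series k) (radius_at k w)),
    0 < w < w0 ->
    (w ^ 5) ^ k * w ^ 2 * sigma <= Rabs theta <= PI * sigma ->
    sigma * Cmod (khinchin_charfun (power_partition_series k) (radius_at k w) theta) <= c * w.
Proof.
move=> hk; have [c [hc hminor]] := minor_arc hk.
set q := INR (2 * k * k`!).
have hq : 1 <= q.
  by apply: (leR_nat (m := 1)); rewrite muln_gt0 fact_gt0 muln_gt0 hk.
set c' := c / (2 * q).
have hc' : 0 < c' by apply: Rdiv_lt_0_compat; lra.
(* One power of w more than in the bound for sigma. *)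
set m := (5 * k + 6)%N.
have hm : 0 < INR m ^ m by apply: pow_lt; apply: lt_0_INR; rewrite /m addnS; lia.
exists (30 * (INR m ^ m / c' ^ m)), (/ q); split.
  by apply: Rmult_lt_0_compat; [lra | apply: Rdiv_lt_0_compat => //; exact: pow_lt].
have hq1 : 0 < / q <= 1.
  by split; [apply: Rinv_0_lt_compat; lra | rewrite -Rinv_1; apply: Rinv_le_contravar; lra].
split=> // w theta sigma hw hth.
have hw0 : 0 < w by lra.
have hw1 : w <= 1 by lra.
have hu := u_pos hw0; have hu1 := u_le1 hw0 hw1.
have hsg : 0 < sigma := sigma_pos hk hw0 hw1.
have hsu : sigma <= _ := sigma_upper hk hw0 hw1.
set u := w ^ 5 in hu hu1 hth *.
have huq : u * q <= 1.
  have h1 : u <= w by rewrite -[X in _ <= X]pow_1; apply: pow_decr; [lra|].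
  have h2 : w * q <= / q * q by apply: Rmult_le_compat_r; lra.
  by rewrite Rinv_l in h2; nra.
have hy : 1 <= / (u * q).
  by rewrite -{1}Rinv_1; apply: Rinv_le_contravar; [apply: Rmult_lt_0_compat; lra | lra].
(* J is the integer part of 1 / (2 k k! u); it is at least half of that number,
   because the latter is at least 1. *)
have [J [hJ1 hJ2]] := nfloor_ex (/ (u * q)) ltac:(lra).
have hJ0 : (0 < J)%N.
  by case: J hJ1 hJ2 => [|J] //= _ h; lra.
have hJR : 1 <= INR J by exact: (leR_nat hJ0).
have hJu : INR (2 * k * (k`! * J)) * u <= 1.
  rewrite mulnA -multE mult_INR -/q.
  have h : INR J * (u * q) <= / (u * q) * (u * q).
    by apply: Rmult_le_compat_r => //; nra.
  rewrite Rinv_l in h; [lra | nra].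
have hJl : / (2 * q * u) <= INR J.
  have -> : / (2 * q * u) = / (u * q) / 2 by field; lra.
  lra.
rewrite (charfun_radius hk hw0 hw1) Cmod_mult Cmod_expi Rmult_1_r.
rewrite -/sigma -/u; set phi := theta / sigma.
have ephi : theta = phi * sigma by rewrite /phi; field; lra.
have hphi : u ^ k * w ^ 2 <= Rabs phi <= PI.
  rewrite ephi Rabs_mult (Rabs_pos_eq sigma) in hth; last lra.
  by case: hth => h1 h2; split; apply: (Rmult_le_reg_r sigma).
have heta : 0 < w ^ 2 <= 1 by split; [exact: pow_lt | nra].
have hcf := hminor u (w ^ 2) phi J hu heta hJ0 hJu hphi.
have hexp : exp (- (c * ((w ^ 2) ^ 2 * INR J))) <= INR m ^ m / c' ^ m * w ^ m.
  have hx : 0 < c' / w by exact: Rdiv_lt_0_compat.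
  apply: (Rle_trans _ (exp (- (c' / w)))).
    apply: exp_le; apply: Ropp_le_contravar.
    have -> : c' / w = c * ((w ^ 2) ^ 2 * / (2 * q * u)) by rewrite /c' /u; field; lra.
    apply: Rmult_le_compat_l; first lra.
    by apply: Rmult_le_compat_l => //; exact: pow2_ge_0.
  have h := pow_le_exp m (Rlt_le _ _ hx).
  have hcm : 0 < c' ^ m by exact: pow_lt.
  have hwm : 0 < w ^ m by exact: pow_lt.
  have e1 : (c' / w) ^ m = c' ^ m / w ^ m by rewrite /Rdiv Rpow_mult_distr pow_inv.
  rewrite e1 in h; rewrite exp_Ropp; have he := exp_pos (c' / w).
  apply: (Rmult_le_reg_l (exp (c' / w))) => //.
  rewrite Rinv_r; last lra.
  apply: (Rmult_le_reg_l (c' ^ m / w ^ m)); first exact: Rdiv_lt_0_compat.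
  rewrite Rmult_1_r; apply: Rle_trans h _; apply: Req_le; field; lra.
apply: (Rle_trans _ (30 / w ^ (5 * k + 5)%N * (INR m ^ m / c' ^ m * w ^ m))).
  apply: Rmult_le_compat => //; [lra | exact: Cmod_ge_0 | exact: Rle_trans hexp].
have hcm : 0 < c' ^ m by exact: pow_lt.
have hw5 : 0 < w ^ (5 * k + 5)%N by exact: pow_lt.
have -> : w ^ m = w * w ^ (5 * k + 5)%N by rewrite /m addnS.
by apply: Req_le; field; lra.
Qed.

(** The cut is s w^2; it is capped by pi only to be admissible far from the
    boundary, where the parameter w is large. *)
Lemma hayman_partition k : (0 < k)%N -> hayman (power_partition_series k).
Proof.
move=> hk; split; first exact: classK_partition.
rewrite CV_radius_partition //; split.
  move=> P [M hM]; set M' := Rmax M 1.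
  have hM' : 1 <= M' by exact: Rmax_r.
  apply: (@left_nbhs_radius k _ (/ (2 * M'))) => //; first by apply: Rinv_0_lt_compat; lra.
  move=> w hw; apply: hM.
  have hw1 : w <= 1.
    by have : / (2 * M') <= / 1 by [apply: Rinv_le_contravar; lra]; lra.
  have h := sigma_lower hk (proj1 hw) hw1.
  apply: Rlt_le_trans h; apply: Rle_lt_trans (Rmax_l M 1) _; rewrite -/M'.
  rewrite -[M']Rinv_inv; apply: Rinv_0_lt_contravar; first lra.
  have : / (2 * M') = / M' / 2 by field; lra.
  lra.
have hpi := PI_half_bounds.
pose h t := Rmin PI (scale_at k t ^ (5 * k + 2)%N).
have hh w : 0 < w <= 1 -> h (radius_at k w) = (w ^ 5) ^ k * w ^ 2.
  move=> hw; rewrite /h radius_atK //; last lra.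
  rewrite -pow_mult -pow_add -[((5 * k)%coq_nat + 2)%coq_nat]/(5 * k + 2)%N.
  apply: Rmin_right; apply: (Rle_trans _ 1); last lra.
  by rewrite -(pow1 (5 * k + 2)); apply: pow_incr; lra.
exists h; split.
  move=> t _ _; split; last exact: Rmin_l.
  by apply: Rmin_pos; [lra | apply: pow_lt; exact: exp_pos].
split.
  apply: (@filterlim_radius0 k _ 20736 (/ 20736)) => //; try lra.
  move=> w hw; have hw1 : w <= 1 by lra.
  rewrite hh; last lra.
  apply: sup_on_bounds; first lra.
  by move=> theta hth; apply: charfun_major_arc => //; lra.
have [c [w0 [hc [hw0 hmin]]]] := charfun_minor_arc hk.
apply: (@filterlim_radius0 k _ c w0) => //; try lra.
move=> w hw; have hw1 : w <= 1 by lra.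
have hsg := sigma_pos hk (proj1 hw) hw1.
rewrite hh; last lra.
set sg := khinchin_sigma _ _ in hsg *.
set sup := sup_on _ _.
have hsup : 0 <= sup <= c * w / sg.
  apply: sup_on_bounds.
    by apply: Rdiv_le_0_compat => //; apply: Rmult_le_pos; lra.
  move=> theta hth; apply: (Rmult_le_reg_l sg) => //.
  have -> : sg * (c * w / sg) = c * w by field; lra.
  by apply: hmin => //; rewrite -/sg; lra.
split; first by apply: Rmult_le_pos; lra.
have -> : c * w = sg * (c * w / sg) by field; lra.
by apply: Rmult_le_compat_l; lra.
Qed.

Theorem theorem2 (k : nat) (hk : (1 <= k)%N) :
  (forall z : C, Cmod z < 1 ->
     exists P : C,
       is_pseries (fun n => RtoC (power_partition_series k n)) z P /\
       filterlim (power_partial_product k z) eventually (locally P)) /\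
  hayman (power_partition_series k).
Proof.
split; last exact: hayman_partition.
move=> z hz; exists (partition_gf k z); split; first exact: is_pseries_partition.
by apply: is_Clim_seq_filterlim; exact: power_product_lim.
Qed.
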